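(* Let $(M,g)$ be a Riemannian manifold of dimension $m=n+1$ with $n\geq1$, with a metric connection $\nabla$ (i.e. $\nabla g=0$, torsion allowed). For any smooth function $r:M\to\mathbb{R}^+$, the restriction of the 1-form $\mu$ to the $(2n+1)$-dimensional submanifold $S_rM=\{u\in TM:\ \|u\|_g=r(\pi(u))\}$ of $TM$ defines a contact structure on $S_rM$, i.e. $\iota^*\mu\wedge(d\,\iota^*\mu)^n$ is nowhere zero on $S_rM$, where $\iota:S_rM\to TM$ is the inclusion.
   Context: Let $\pi:TM\to M$ be the bundle projection and $V=\ker d\pi\subset TTM$ the vertical bundle, canonically identified with $\pi^*TM$. Let $\xi$ be the canonical vertical vector field on $TM$, $\xi_u=u$, and $\nabla^*=\pi^*\nabla$ the pull-back connection on $\pi^*TM$. Then $H=\{X\in TTM:\ \nabla^*_X\xi=0\}$ is a complement of $V$ and $d\pi$ restricts to an isomorphism $H\cong\pi^*TM$. The endomorphism $\theta:TTM\to TTM$ sends a horizontal vector to the vertical vector corresponding to it under $H\cong\pi^*TM\cong V$, and sends $V$ to $0$. With $\langle\ ,\ \rangle$ the Sasaki metric $\pi^*g\oplus\pi^*g$ on $TTM=H\oplus V$, the 1-form $\mu$ on $TM$ is $\mu=\xi^\flat\circ\theta$, i.e. $\mu(X)=\langle\xi,\theta X\rangle$. Equivalently, $\mu_u(X)=g(u,d\pi(X))$ for $X\in T_uTM$ (the pull-back of the Liouville form of $T^*M$ under the musical isomorphism; it does not depend on $\nabla$). *)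

(* Defs.v *)
From HB Require Import structures.
From mathcomp Require Import all_boot all_order all_algebra all_fingroup.
From mathcomp Require Import all_classical all_reals all_analysis.

Set Implicit Arguments.
Unset Strict Implicit.
Unset Printing Implicit Defensive.

Import Order.TTheory GRing.Theory Num.Theory.
Import numFieldNormedType.Exports.
Local Open Scope classical_set_scope.
Local Open Scope ring_scope.

(* The spaces are meant to be finite-dimensional and [U] to be open. *)
Fixpoint Ck (R : realType) (V W : normedModType R) (k : nat) (U : set V)
    (f : V -> W) : Prop :=
  match k with
  | 0 => forall x, U x -> {for x, continuous f}
  | k'.+1 => (forall x, U x -> differentiable f x) /\
             (forall v, Ck k' U (fun x => 'd f x v))
  end.

Definition smooth_on (R : realType) (V W : normedModType R) (U : set V)
    (f : V -> W) : Prop := forall k, Ck k U f.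

(* The data of an atlas with model space [E]: [chart i] is the coordinate map
   of the chart [i], meaningful on [cdom i]; [chart_inv i] is its inverse,
   meaningful on [chart i @` cdom i]; [chart_at p] is a preferred chart at [p].
   The conditions making this a smooth manifold are in [smooth_atlas]. *)
Record atlas (R : realType) (E : normedModType R) := Atlas {
  mpoint :> Type;
  chart_index : Type;
  cdom : chart_index -> set mpoint;
  chart : chart_index -> mpoint -> E;
  chart_inv : chart_index -> E -> mpoint;
  chart_at : mpoint -> chart_index }.

Arguments cdom {R E a} i.
Arguments chart {R E a} i p.
Arguments chart_inv {R E a} i x.
Arguments chart_at {R E a} p.

(* The manifold topology is the one determined by the charts. *)
Section atlas_topology.
Context {R : realType} {E : normedModType R} (M : atlas E).

Definition atlas_open : set_system (mpoint M) := [set O |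
  forall p i, O p -> cdom i p -> \forall x \near chart i p, O (chart_inv i x)].

Lemma atlas_openT : atlas_open setT.
Proof. by move=> p i _ _; exact: filterT. Qed.

Lemma atlas_openI : setI_closed atlas_open.
Proof.
by move=> A B oA oB p i [Ap Bp] ip; apply: filterI; [exact: oA|exact: oB].
Qed.

Lemma atlas_open_bigU (I : Type) (f : I -> set (mpoint M)) :
  (forall i, atlas_open (f i)) -> atlas_open (\bigcup_i f i).
Proof.
move=> of_ p i [j _ fjp] ip; apply: filterS (of_ j p i fjp ip) => x fx.
by exists j.
Qed.

HB.instance Definition _ := gen_eqMixin (mpoint M).
HB.instance Definition _ := gen_choiceMixin (mpoint M).
HB.instance Definition _ := isOpenTopological.Build (mpoint M)
  atlas_openT atlas_openI atlas_open_bigU.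
End atlas_topology.

Definition smooth_atlas (R : realType) (E : normedModType R) (M : atlas E) :
    Prop :=
  [/\ forall p : M, cdom (chart_at p) p,
      forall (i : chart_index M) p, cdom i p -> chart_inv i (chart i p) = p,
      forall i j : chart_index M, open (chart i @` (cdom i `&` cdom j)) &
      forall i j : chart_index M,
        smooth_on (chart i @` (cdom i `&` cdom j)) (chart j \o chart_inv i)].

Definition smooth_manifold (R : realType) (E : normedModType R) (M : atlas E) :
    Prop :=
  [/\ smooth_atlas M, hausdorff_space M & @second_countable M].

Definition smooth_map (R : realType) (E F : normedModType R)
    (N : atlas F) (M : atlas E) (f : N -> M) : Prop :=
  forall (i : chart_index N) (j : chart_index M),
    open (chart i @` (cdom i `&` f @^-1` cdom j)) /\
    smooth_on (chart i @` (cdom i `&` f @^-1` cdom j))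
      (chart j \o f \o chart_inv i).

Definition smooth_fun (R : realType) (E : normedModType R) (M : atlas E)
    (U : set M) (h : M -> R) : Prop :=
  forall i : chart_index M,
    smooth_on (chart i @` (U `&` cdom i)) ((h \o chart_inv i : E -> R^o)).

(* A tangent vector at [p] is represented by its components in the preferred
   chart [chart_at p], so that T_pM is the model space [E] for every [p], and a
   vector field is a map [M -> E]. [tcoord i p] and [tvect i p] are the changes
   to and from components in a chart [i] around [p]. *)

Definition tcoord (R : realType) (E : normedModType R) (M : atlas E)
    (i : chart_index M) (p : M) (v : E) : E :=
  'd (chart i \o chart_inv (chart_at p)) (chart (chart_at p) p) v.

Definition tvect (R : realType) (E : normedModType R) (M : atlas E)
    (i : chart_index M) (p : M) (w : E) : E :=
  'd (chart (chart_at p) \o chart_inv i) (chart i p) w.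

Definition differential (R : realType) (E F : normedModType R)
    (N : atlas F) (M : atlas E) (f : N -> M) (p : N) (X : F) : E :=
  'd (chart (chart_at (f p)) \o f \o chart_inv (chart_at p))
     (chart (chart_at p) p) X.

Definition dfun (R : realType) (E : normedModType R) (M : atlas E)
    (h : M -> R) (p : M) (X : E) : R :=
  'd (h \o chart_inv (chart_at p) : E -> R^o) (chart (chart_at p) p) X.

Definition velocity (R : realType) (E : normedModType R) (M : atlas E)
    (c : R -> M) : E :=
  derive1 (fun t : R => chart (chart_at (c 0)) (c t)) 0.

(* The total space TM, whose points are the pairs (p, v) with v in T_pM. *)
Definition tangent_bundle (R : realType) (E : normedModType R) (M : atlas E) :
    atlas (E * E)%type :=
  {| mpoint := (M * E)%type;
     chart_index := chart_index M;
     cdom := fun i => [set u | cdom i u.1];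
     chart := fun i u => (chart i u.1, tcoord i u.1 u.2);
     chart_inv := fun i x => (chart_inv i x.1, tvect i (chart_inv i x.1) x.2);
     chart_at := fun u => chart_at u.1 |}.

Definition tproj (R : realType) (E : normedModType R) (M : atlas E)
    (u : tangent_bundle M) : M := u.1.

Definition altform (R : realType) (E : normedModType R) (k : nat) : Type :=
  ('I_k -> E) -> R.

Definition dform (R : realType) (E : normedModType R) (M : atlas E) (k : nat) :
    Type := M -> altform E k.

Definition wedge (R : realType) (E : normedModType R) (k l : nat)
    (a : altform E k) (b : altform E l) : altform E (k + l) :=
  fun v => ((k`! * l`!)%N%:R)^-1 *
    \sum_(s : 'S_(k + l)) (-1) ^+ s *
       (a (fun i => v (s (lshift l i))) * b (fun j => v (s (rshift k j)))).

Fixpoint wedge_exp (R : realType) (E : normedModType R) (k : nat)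
    (b : altform E k) (n : nat) : altform E (n * k) :=
  match n with
  | 0 => fun _ => 1
  | n'.+1 => wedge b (@wedge_exp R E k b n')
  end.

(* The usual coordinate formula, in the preferred chart [c] at [p] and with the
   vectors v_0, ..., v_k extended as fields with constant components in [c]. *)
Definition extd (R : realType) (E : normedModType R) (M : atlas E) (k : nat)
    (w : dform M k) : dform M k.+1 :=
  fun p v => let c := chart_at p in
    \sum_(i < k.+1) (-1) ^+ i *
      'D_(v i) (fun x : E => w (chart_inv c x)
        (fun j => tvect c (chart_inv c x) (v (lift i j))) : R^o) (chart c p).

Definition pullback (R : realType) (E F : normedModType R)
    (N : atlas F) (M : atlas E) (f : N -> M) (k : nat) (w : dform M k) :
    dform N k :=
  fun p v => w (f p) (fun i => differential f p (v i)).

Definition contact_form (R : realType) (E : normedModType R) (M : atlas E)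
    (n : nat) (a : dform M 1) : Prop :=
  forall p : M, exists v, wedge (a p) (@wedge_exp R E 2 (extd a p) n) v != 0.

(* The Hausdorff and second countability properties of a submanifold are
   inherited from the ambient manifold, through the last condition. *)
Definition submanifold_embedding (R : realType) (E F : normedModType R)
    (S : atlas F) (N : atlas E) (iota : S -> N) (A : set N) : Prop :=
  [/\ smooth_atlas S,
      smooth_map iota,
      forall p, injective (differential iota p),
      injective iota /\ range iota = A &
      forall O : set S, open O <-> exists2 O', open O' & O = iota @^-1` O'].

Definition riemannian_metric (R : realType) (E : normedModType R) (M : atlas E)
    (g : M -> E -> E -> R) : Prop :=
  [/\ forall p v w, g p v w = g p w v,
      forall p a u v w, g p (a *: u + v) w = a * g p u w + g p v w,
      forall p v, v != 0 -> 0 < g p v v &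
      forall (i : chart_index M) v w, smooth_on (chart i @` cdom i)
        (fun x : E => g (chart_inv i x) (tvect i (chart_inv i x) v)
                                    (tvect i (chart_inv i x) w) : R^o)].

(* Sections over [U] of the pull-back bundle f^*TM: s q is in T_(f q)M.
   For f = idfun they are the vector fields on [U]. *)
Definition smooth_section (R : realType) (E F : normedModType R)
    (N : atlas F) (M : atlas E) (f : N -> M) (U : set N) (s : N -> E) : Prop :=
  forall (i : chart_index N) (j : chart_index M),
    smooth_on (chart i @` (U `&` cdom i `&` f @^-1` cdom j))
      (fun x => tcoord j (f (chart_inv i x)) (s (chart_inv i x))).

(* A connection on f^*TM, acting on local sections: [D q X s] is D_X s for X in
   T_qN, and it is only constrained when [s] is smooth on some neighbourhood
   of [q] (outside of which the values of [s] are irrelevant: by the Leibniz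
   rule [D q X s] depends only on the germ of [s] at [q]). *)
Definition connection (R : realType) (E F : normedModType R)
    (N : atlas F) (M : atlas E) (f : N -> M) (D : N -> F -> (N -> E) -> E) :
    Prop :=
  forall U : set N, open U ->
  [/\ forall q s a X Y, U q -> smooth_section f U s ->
        D q (a *: X + Y) s = a *: D q X s + D q Y s,
      forall q X s t, U q -> smooth_section f U s -> smooth_section f U t ->
        D q X (fun q' => s q' + t q') = D q X s + D q X t,
      forall q X h s, U q -> smooth_fun U h -> smooth_section f U s ->
        D q X (fun q' => h q' *: s q') = dfun h q X *: s q + h q *: D q X s &
      forall X s, smooth_section idfun U X -> smooth_section f U s ->
        smooth_section f U (fun q => D q (X q) s)].

Definition metric_connection (R : realType) (E : normedModType R)
    (M : atlas E) (g : M -> E -> E -> R) (D : M -> E -> (M -> E) -> E) : Prop :=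
  connection idfun D /\
  forall (U : set M) p v s t, open U -> U p ->
    smooth_section idfun U s -> smooth_section idfun U t ->
    dfun (fun q => g q (s q) (t q)) p v =
      g p (D p v s) (t p) + g p (s p) (D p v t).

(* [D'] is the pull-back f^*D: the connection on f^*TM determined by
   (f^*D)_X (s \o f) = D_(df X) s for local sections s of TM. *)
Definition pullback_connection (R : realType) (E F : normedModType R)
    (N : atlas F) (M : atlas E) (f : N -> M) (D : M -> E -> (M -> E) -> E)
    (D' : N -> F -> (N -> E) -> E) : Prop :=
  connection f D' /\
  forall (U : set M) q X s, open U -> U (f q) -> smooth_section idfun U s ->
    D' q X (s \o f) = D (f q) (differential f q X) s.

Section tangent_bundle_geometry.
Context {R : realType} {E : normedModType R} (M : atlas E).
Let TM := tangent_bundle M.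
Variables (g : M -> E -> E -> R) (nablas : TM -> E * E -> (TM -> E) -> E).
(* [nablas] stands for the pull-back connection nabla^* on pi^*TM. *)

Definition vertical (u : TM) : set (E * E) :=
  [set X | differential (@tproj R E M) u X = 0].

(* The section xi of pi^*TM. *)
Definition taut_section (u : TM) : E := u.2.

Definition horizontal (u : TM) : set (E * E) :=
  [set X | nablas u X taut_section = 0].

(* The identification pi^*TM -> V *)
Definition vlift (u : TM) (a : E) : E * E :=
  velocity (fun t : R => (u.1, u.2 + t *: a) : TM).

Definition vlift_inv (u : TM) (X : E * E) : E := xget 0 [set a | vlift u a = X].

(* The components of X with respect to H + V *)
Definition hpart (u : TM) (X : E * E) : E * E :=
  xget 0 [set Y | horizontal u Y /\ vertical u (X - Y)].

Definition vpart (u : TM) (X : E * E) : E * E := X - hpart u X.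

Definition theta (u : TM) (X : E * E) : E * E :=
  vlift u (differential (@tproj R E M) u (hpart u X)).

Definition sasaki (u : TM) (X Y : E * E) : R :=
  g (tproj u) (differential (@tproj R E M) u (hpart u X))
              (differential (@tproj R E M) u (hpart u Y))
  + g (tproj u) (vlift_inv u (vpart u X)) (vlift_inv u (vpart u Y)).

Definition xi (u : TM) : E * E := vlift u (taut_section u).

Definition mu : dform TM 1 := fun u X => sasaki u (xi u) (theta u (X ord0)).

Definition sphere_bundle (r : M -> R) : set TM :=
  [set u | Num.sqrt (g (tproj u) u.2 u.2) = r (tproj u)].

End tangent_bundle_geometry.

(* Main.v *)
(* By the Leibniz rule, the pull-back connection maps xi to X along a vertical
   vector X, so TTM splits as H + V and mu_u(X) = g(u, dpi X).  In coordinates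
   (x, w) of TM, the Legendre transform beta = g_x(w, .) turns mu into
   sum_j beta_j dx^j, and d mu into sum_j d beta_j /\ dx^j by symmetry of second
   derivatives.  The Liouville field beta d/dbeta is transverse to S_rM, since
   the norm is homogeneous along the fibres while r is constant along them.
   Projecting to T(S_rM) along this field changes neither mu nor the restriction
   of d mu to ker mu, so T(S_rM) contains a vector on which mu > 0 and a
   standard symplectic basis of ker mu; on these, every term of the permutation
   expansion of mu /\ (d mu)^n is nonnegative, and some term is positive.
   S_rM itself is covered by explicit charts: (x, w) goes to x and to the ratios
   w_j / w_k on the set where w_k has a given sign. *)

From HB Require Import structures.
Require Import Defs.
From mathcomp Require Import all_boot all_order all_algebra all_fingroup zify.
From mathcomp Require Import all_classical all_reals all_analysis.

Set Implicit Arguments.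
Unset Strict Implicit.
Unset Printing Implicit Defensive.

Import Order.TTheory GRing.Theory Num.Theory.
Import numFieldNormedType.Exports.
Local Open Scope classical_set_scope.
Local Open Scope ring_scope.

(** * Differentials and smooth maps *)

(** The contact condition is proved for an arbitrary atlas [S] embedded onto the sphere bundle, so
    only an immersion and the equation of its image are available. In one chart this leaves two maps
    on an open set of R^(2n+1), the base coordinates [X] and the fibre coordinates [W], bound by an
    equation [W G(X) W^T = rho(X)]. The derivatives of the metric and of [r] are unknown, but they
    enter only through the differential of [X]; the conditions imposed on the differentials are
    therefore stated on its kernel, and a nonconstant [r] costs nothing there. The vectors of the
    symplectic basis are not written down: they come from the bijectivity of one linear map between
    spaces of dimension 2n+2. They realize prescribed differentials only up to multiples of the
    Liouville direction, an error that disappears because [mu] vanishes on the basis. Since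
    [smooth_on] speaks of iterated directional derivatives along fixed vectors, composing smooth
    maps requires coordinates on the middle space; this is the purpose of [fin_basis]. *)

Section diff_facts.
Context {R : realType}.
Implicit Types V W Z : normedModType R.

Lemma is_diff_val V W (f : V -> W) x df v : is_diff x f df -> 'd f x v = df v.
Proof. by move=> fx; rewrite (diff_val (f := f)). Qed.

(** The first-order expansion at [x] involves only the germ of the map, so the expansion of [f] is
    one for [g], and uniqueness of the differential concludes. Chart expressions agree only near a
    point, which makes this the basic tool for them. *)
Lemma near_is_diff V W (f g : V -> W) x :
  (\near x, f x = g x) -> differentiable f x -> is_diff x g ('d f x).
Proof.
move=> fg /diff_locallyP [dfc fE].
have gE : g \o shift x = cst (g x) + 'd f x +o_ 0 id.
  apply/eqaddoP => _ /posnumP[e].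
  have /eqaddoP/(_ e%:num) := fE.
  move=> /(_ [elaborate gt0 e]) H; near=> h.
  have -> : (g \o shift x - (cst (g x) + 'd f x : V -> W)) h
          = (f \o shift x - (cst (f x) + 'd f x : V -> W)) h.
    rewrite !fctE /= -(nbhs_singleton fg).
    congr (_ - _); apply/esym; near: h.
    by move: fg; rewrite (near_shift 0) subr0.
  by near: h.
have gd : 'd g x = 'd f x :> (V -> W) by apply: diff_unique.
apply: DiffDef; last exact: gd.
by apply/diff_locallyP; rewrite gd; split.
Unshelve. all: by end_near. Qed.

Lemma near_diff V W (f g : V -> W) x v :
  (\near x, f x = g x) -> differentiable f x -> 'd g x v = 'd f x v.
Proof. by move=> fg df; have := near_is_diff fg df => /is_diff_val ->. Qed.

Lemma near_differentiable V W (f g : V -> W) x :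
  (\near x, f x = g x) -> differentiable f x -> differentiable g x.
Proof. by move=> fg df; have [] := near_is_diff fg df. Qed.

Lemma diff_compE V W Z (f : V -> W) (g : W -> Z) x v :
  differentiable f x -> differentiable g (f x) ->
  'd (g \o f) x v = 'd g (f x) ('d f x v).
Proof. by move=> df dg; rewrite diff_comp. Qed.

(** Scaling is packed as a continuous bilinear map [b]; the Leibniz rule is then the chain rule for
    [b] after the pair of [h] and [f]. *)
Lemma is_diff_scale V W (h : V -> R^o) (f : V -> W) x :
  differentiable h x -> differentiable f x ->
  is_diff x (fun y => h y *: f y)
    (fun v => h x *: 'd f x v + 'd h x v *: f x).
Proof.
move=> dh df.
have bil : bilinear_for
    (GRing.Scale.Law.clone _ _ *:%R _) (GRing.Scale.Law.clone _ _ *:%R _)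
    (fun (a : R^o) (w : W) => a *: w).
  split=> [w|a] c u v /=; first by rewrite scalerDl scalerA.
  by rewrite scalerDr !scalerA mulrC.
pose bM := @bilinear_isBilinear.Build R R^o W W _ _ _ bil.
pose b : {bilinear R^o -> W -> W} := HB.pack (fun (a : R^o) (w : W) => a *: w) bM.
have bc : continuous (fun p : R^o * W => b p.1 p.2).
  exact: (@scale_continuous R W).
have -> : (fun y => h y *: f y)
  = (fun p => b p.1 p.2) \o (fun y => (h y, f y)) by [].
apply: DiffDef.
  apply: differentiable_comp; first exact: differentiable_pair.
  exact: differentiable_bilin.
rewrite diff_comp; [|exact: differentiable_pair|exact: differentiable_bilin].
by rewrite diff_bilin // diff_pair.
Qed.

End diff_facts.

(** * Calculus of maps of class C^k *)

Section Ck_facts.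
Context {R : realType}.
Implicit Types V W Z : normedModType R.

Lemma open_near (T : topologicalType) (U : set T) x :
  open U -> U x -> \forall y \near x, U y.
Proof. by move=> oU Ux; apply: open_nbhs_nbhs. Qed.

Lemma is_diff_linear V W (f : V -> W) x : linear f -> continuous f -> is_diff x f f.
Proof.
move=> lf cf; pose fM := GRing.isLinear.Build _ _ _ _ _ lf.
pose fL : {linear V -> W} := HB.pack f fM.
by apply: DiffDef; [exact: (@linear_differentiable _ _ _ fL)|exact: (@diff_lin _ _ _ fL)].
Qed.

Lemma Ck_continuous V W k U (f : V -> W) x :
  Ck k U f -> U x -> {for x, continuous f}.
Proof.
case: k => [|k] /=; first by move=> H; exact: H.
by move=> [H _] /H; exact: differentiable_continuous.
Qed.

Lemma CkW V W k U (f : V -> W) : Ck k.+1 U f -> Ck k U f.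
Proof.
elim: k f => [|k IH] f [df Df]; first by move=> x /df /differentiable_continuous.
by split=> // v; apply: IH; exact: Df.
Qed.

Lemma Ck_sub V W k (U U' : set V) (f : V -> W) : U' `<=` U -> Ck k U f -> Ck k U' f.
Proof.
move=> UU'; elim: k f => [|k IH] f /=; first by move=> H x /UU'; exact: H.
by move=> [H1 H2]; split=> [x /UU'|v]; [exact: H1|exact: IH].
Qed.

Lemma Ck_eq V W k (U : set V) (f g : V -> W) :
  open U -> (forall x, U x -> f x = g x) -> Ck k U f -> Ck k U g.
Proof.
move=> oU; elim: k f g => [|k IH] f g fg /=.
  move=> fc x Ux; rewrite /prop_for /continuous_at -(fg x Ux).
  apply: cvg_trans (fc x Ux); apply: near_eq_cvg.
  by near do apply: fg; exact: open_near.
have fgn x : U x -> \near x, f x = g x.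
  by move=> Ux; near do apply: fg; exact: open_near.
move=> [df Df]; split=> [x Ux|v].
  by apply: near_differentiable (fgn x Ux) (df x Ux).
apply: IH (Df v) => x Ux; symmetry.
exact: near_diff (fgn x Ux) (df x Ux).
Unshelve. all: by end_near. Qed.

Lemma Ck_cst V W k (U : set V) (a : W) : Ck k U (cst a : V -> W).
Proof.
elim: k a => [|k IH] a /=; first by move=> x _; exact: cst_continuous.
split=> [x _|v]; first exact: differentiable_cst.
rewrite (_ : (fun _ => _) = cst 0); first exact: IH.
by apply/funext => x; rewrite diff_cst.
Qed.

Lemma Ck_linear V W k (U : set V) (f : V -> W) :
  linear f -> continuous f -> Ck k U f.
Proof.
move=> lf cf; case: k => [|k] /=; first by move=> x _; exact: cf.
have df x := is_diff_linear x lf cf.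
split=> [x _|v]; first by have [] := df x.
rewrite (_ : (fun _ => _) = cst (f v)); first exact: Ck_cst.
by apply/funext => x; rewrite (is_diff_val _ (df x)).
Qed.

Lemma Ck_add V W k (U : set V) (f g : V -> W) : open U ->
  Ck k U f -> Ck k U g -> Ck k U (fun x => f x + g x).
Proof.
move=> oU; elim: k f g => [|k IH] f g /=.
  by move=> fc gc x Ux; apply: continuousD; [exact: fc|exact: gc].
move=> [df Df] [dg Dg]; split=> [x Ux|v].
  by apply: differentiableD; [exact: df|exact: dg].
apply: Ck_eq (IH _ _ (Df v) (Dg v)) => // x Ux.
exact: esym (congr1 (fun h => h v) (diffD (df x Ux) (dg x Ux))).
Qed.

Lemma Ck_sum V W k (U : set V) d (f : 'I_d -> V -> W) : open U ->
  (forall i, Ck k U (f i)) -> Ck k U (fun x => \sum_i f i x).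
Proof.
move=> oU Hf.
suff H (s : seq 'I_d) : Ck k U (fun x => \sum_(i <- s) f i x) by exact: H.
elim: s => [|i s IH].
  by under eq_fun do rewrite big_nil; exact: Ck_cst.
by under eq_fun do rewrite big_cons; apply: Ck_add.
Qed.

(** By the Leibniz rule the derivative is a sum of two products of maps of class k; [CkW] lowers the
    order of the factor that is not differentiated. *)
Lemma Ck_scale V W k (U : set V) (h : V -> R^o) (f : V -> W) : open U ->
  Ck k U h -> Ck k U f -> Ck k U (fun x => h x *: f x).
Proof.
move=> oU; elim: k h f => [|k IH] h f.
  by move=> fc gc x Ux; apply: cvgZ; [exact: fc|exact: gc].
move=> Hh Hf; have [dh Dh] := Hh; have [df Df] := Hf; split=> [x Ux|v].
  by have [] := is_diff_scale (dh x Ux) (df x Ux).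
apply: (@Ck_eq _ _ _ _ (fun x => h x *: 'd f x v + 'd h x v *: f x)) => //.
  by move=> x Ux; exact: esym (is_diff_val v (is_diff_scale (dh x Ux) (df x Ux))).
apply: Ck_add => //; apply: IH; [exact: CkW Hh|exact: Df|exact: Dh|exact: CkW Hf].
Qed.

Lemma Ck_linear_comp V W Z k (U : set V) (f : V -> W) (c : W -> Z) :
  linear c -> continuous c -> open U -> Ck k U f -> Ck k U (fun x => c (f x)).
Proof.
move=> lc cc oU; elim: k f => [|k IH] f.
  by move=> fc x Ux; apply: continuous_comp; [exact: fc|exact: cc].
have dc y := is_diff_linear y lc cc.
move=> [df Df]; split=> [x Ux|v].
  by apply: differentiable_comp; [exact: df|have [] := dc (f x)].
apply: Ck_eq (IH _ (Df v)) => // x Ux.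
rewrite -[in RHS]/(c \o f) [RHS]diff_compE; [|exact: df|by have [] := dc (f x)].
by rewrite (is_diff_val _ (dc _)).
Qed.

(** Finite dimension in the form in which it is consumed: every vector expands along fixed vectors
    [e i] with coefficients that are linear and continuous. *)
Definition fin_basis W := exists (d : nat) (e : 'I_d -> W) (c : 'I_d -> W -> R^o),
  (forall i, linear (c i) /\ continuous (c i)) /\ forall w, w = \sum_i c i w *: e i.

(* The differential of a composite is expanded along the basis of the middle
   space, which reduces it to directional derivatives along fixed vectors. *)
Lemma Ck_comp V W Z k (U : set V) (U' : set W) (f : V -> W) (g : W -> Z) :
  fin_basis W -> open U -> open U' -> (forall x, U x -> U' (f x)) ->
  Ck k U f -> Ck k U' g -> Ck k U (fun x => g (f x)).
Proof.
move=> [d [e [c [cl ce]]]] oU oU'.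
elim: k Z f g => [|k IH] Z f g UU'.
  move=> fc gc x Ux; apply: continuous_comp; first exact: fc.
  by apply: gc; exact: UU'.
move=> Hf Hg; have [df Df] := Hf; have [dg Dg] := Hg; split=> [x Ux|v].
  by apply: (@differentiable_comp _ _ _ _ f g); [exact: df|apply: dg; exact: UU'].
apply: (@Ck_eq _ _ _ _ (fun x => \sum_i c i ('d f x v) *: 'd g (f x) (e i))) => //.
  move=> x Ux; rewrite -[in RHS]/(g \o f) [RHS]diff_compE; [|exact: df|apply: dg; exact: UU'].
  rewrite [in RHS](ce ('d f x v)) linear_sum; apply: eq_bigr => i _.
  by rewrite linearZ.
apply: Ck_sum => // i; apply: Ck_scale => //.
  by have [lc cc] := cl i; apply: Ck_linear_comp => //; exact: Df.
exact: IH (CkW Hf) (Dg _).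
Qed.

Lemma Ck_pair V W Z k (U : set V) (f : V -> W) (g : V -> Z) :
  open U -> Ck k U f -> Ck k U g -> Ck k U (fun x => (f x, g x)).
Proof.
move=> oU; elim: k f g => [|k IH] f g /=.
  by move=> fc gc x Ux; apply: cvg_pair; [exact: fc|exact: gc].
move=> [df Df] [dg Dg]; split=> [x Ux|v].
  by apply: differentiable_pair; [exact: df|exact: dg].
apply: Ck_eq (IH _ _ (Df v) (Dg v)) => // x Ux.
by rewrite diff_pair; [|exact: df|exact: dg].
Qed.

(** The induction closes because the derivative of 1/x is a product of two copies of 1/x, up to sign
    and a constant. *)
Lemma Ck_inv k : Ck k [set x : R^o | x != 0] (fun x : R^o => x^-1 : R^o).
Proof.
have oU : open [set x : R^o | x != 0].
  rewrite (_ : [set _ | _] = ~` [set 0]); first by rewrite openC; exact: closed_eq.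
  by apply/seteqP; split=> x /eqP.
elim: k => [|k IH]; first by move=> x x0; exact: inv_continuous.
split=> [x x0|v]; first exact: differentiable_Rinv.
apply: (@Ck_eq _ _ _ _ (fun x : R^o => (- x^-1 : R^o) *: (x^-1 *: (v : R^o)))) => //.
  by move=> x x0; rewrite diff_Rinv // scalerA; congr (_ *: _); rewrite mulNr expr2 invfM.
have Ck_invN : Ck k [set x : R^o | x != 0] (fun x : R^o => - x^-1 : R^o).
  apply: (@Ck_linear_comp _ _ _ _ _ (fun x : R^o => x^-1 : R^o) -%R) => //.
    by move=> a u w; rewrite opprD scalerN.
  exact: opp_continuous.
apply: Ck_scale => //; apply: (@Ck_scale _ _ _ _ (fun x : R^o => x^-1 : R^o)) => //.
exact: Ck_cst.
Qed.

Lemma Ck_scaleR V k (U : set V) (f g : V -> R^o) : open U ->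
  Ck k U f -> Ck k U g -> Ck k U (fun x => f x * g x : R^o).
Proof. by move=> oU; exact: Ck_scale. Qed.

Lemma fin_basis_R : fin_basis R^o.
Proof.
exists 1%N, (fun=> 1), (fun=> idfun); split.
  by move=> i; split=> // x; exact: cvg_id.
by move=> w; rewrite big_ord1 [_ *: _]mulr1.
Qed.

Lemma linear_coord n (i : 'I_n) : linear (fun w : 'rV[R]_n => w ord0 i : R^o).
Proof. by move=> a u v; rewrite !mxE. Qed.

Lemma continuous_coord n (i : 'I_n) :
  continuous (fun w : 'rV[R]_n => w ord0 i : R^o).
Proof. exact: coord_continuous. Qed.

Lemma fin_basis_rV n : fin_basis 'rV[R]_n.
Proof.
exists n, (fun i => delta_mx 0 i), (fun i (w : 'rV[R]_n) => w ord0 i : R^o); split.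
  by move=> i; split; [exact: linear_coord|exact: continuous_coord].
by move=> w; rewrite [LHS]row_sum_delta.
Qed.

Lemma linear_fst V W : linear (fst : V * W -> V). Proof. by []. Qed.
Lemma linear_snd V W : linear (snd : V * W -> W). Proof. by []. Qed.
Lemma continuous_fst V W : continuous (fst : V * W -> V).
Proof. by move=> x; exact: cvg_fst. Qed.
Lemma continuous_snd V W : continuous (snd : V * W -> W).
Proof. by move=> x; exact: cvg_snd. Qed.

(** The derivative 1/(2 sqrt x) is the inverse composed with the square root itself, so the
    induction hypothesis and [Ck_inv] give the next order. *)
Lemma Ck_sqrt k : Ck k [set x : R^o | 0 < x] (fun x : R^o => Num.sqrt x : R^o).
Proof.
have oU : open [set x : R^o | 0 < x] by exact: open_gt.
have osq : open [set x : R^o | x != 0].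
  rewrite (_ : [set _ | _] = ~` [set 0]); first by rewrite openC; exact: closed_eq.
  by apply/seteqP; split=> x /eqP.
elim: k => [|k IH]; first by move=> x x0; exact: sqrt_continuous.
have dsq (x : R^o) : 0 < x -> differentiable (Num.sqrt : R^o -> R^o) x.
  by move=> x0; apply/derivable1_diffP; have [] := is_derive1_sqrt x0.
split=> [x x0|v]; first exact: dsq.
apply: (@Ck_eq _ _ _ _ (fun x : R^o => ((2%:R * Num.sqrt x)^-1 : R^o) *: (v : R^o))) => //.
  move=> x x0; rewrite diff1E; last exact: dsq.
  by rewrite derive1E derive_sqrt // [LHS]mulrC.
apply: Ck_scale => //; last exact: Ck_cst.
apply: (Ck_comp fin_basis_R oU osq _ _ (@Ck_inv k)) => /=.
  by move=> x x0; rewrite mulf_neq0 // gt_eqF // sqrtr_gt0.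
by apply: (@Ck_scale _ _ _ _ (cst 2%:R)) => //; exact: Ck_cst.
Qed.

End Ck_facts.

(** * Smooth maps and the symmetry of second derivatives *)

Section smooth_facts.
Context {R : realType}.
Implicit Types V W Z : normedModType R.

Lemma smooth_differentiable V W (U : set V) (f : V -> W) x :
  smooth_on U f -> U x -> differentiable f x.
Proof. by move=> /(_ 1%N) [df _]; exact: df. Qed.

Lemma smooth_continuous V W (U : set V) (f : V -> W) x :
  smooth_on U f -> U x -> {for x, continuous f}.
Proof. by move=> /(_ 0%N); exact: Ck_continuous. Qed.

Lemma smooth_diff V W (U : set V) (f : V -> W) v :
  smooth_on U f -> smooth_on U (fun x => 'd f x v).
Proof. by move=> sf k; have [_] := sf k.+1; exact. Qed.

Lemma smooth_sub V W (U U' : set V) (f : V -> W) :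
  U' `<=` U -> smooth_on U f -> smooth_on U' f.
Proof. by move=> UU' sf k; exact: Ck_sub (sf k). Qed.

Lemma smooth_eq V W (U : set V) (f g : V -> W) :
  open U -> (forall x, U x -> f x = g x) -> smooth_on U f -> smooth_on U g.
Proof. by move=> oU fg sf k; exact: Ck_eq (sf k). Qed.

Lemma smooth_cst V W (U : set V) (a : W) : smooth_on U (fun=> a : W).
Proof. by move=> k; exact: Ck_cst. Qed.

Lemma smooth_linear V W (U : set V) (f : V -> W) :
  linear f -> continuous f -> smooth_on U f.
Proof. by move=> lf cf k; exact: Ck_linear. Qed.

Lemma smooth_linear_comp V W Z (U : set V) (f : V -> W) (c : W -> Z) :
  linear c -> continuous c -> open U -> smooth_on U f ->
  smooth_on U (fun x => c (f x)).
Proof. by move=> lc cc oU sf k; exact: Ck_linear_comp. Qed.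

Lemma smooth_add V W (U : set V) (f g : V -> W) : open U ->
  smooth_on U f -> smooth_on U g -> smooth_on U (fun x => f x + g x).
Proof. by move=> oU sf sg k; exact: Ck_add. Qed.

Lemma smooth_sum V W (U : set V) d (f : 'I_d -> V -> W) : open U ->
  (forall i, smooth_on U (f i)) -> smooth_on U (fun x => \sum_i f i x).
Proof. by move=> oU sf k; apply: Ck_sum => // i; exact: sf. Qed.

Lemma smooth_scale V W (U : set V) (h : V -> R^o) (f : V -> W) : open U ->
  smooth_on U h -> smooth_on U f -> smooth_on U (fun x => h x *: f x).
Proof. by move=> oU sh sf k; exact: Ck_scale. Qed.

Lemma smooth_mul V (U : set V) (f g : V -> R^o) : open U ->
  smooth_on U f -> smooth_on U g -> smooth_on U (fun x => f x * g x : R^o).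
Proof. by move=> oU sf sg k; exact: Ck_scaleR. Qed.

Lemma smooth_comp V W Z (U : set V) (U' : set W) (f : V -> W) (g : W -> Z) :
  fin_basis W -> open U -> open U' -> (forall x, U x -> U' (f x)) ->
  smooth_on U f -> smooth_on U' g -> smooth_on U (fun x => g (f x)).
Proof. by move=> bW oU oU' UU' sf sg k; exact: Ck_comp (sf k) (sg k). Qed.

Lemma smooth_pair V W Z (U : set V) (f : V -> W) (g : V -> Z) : open U ->
  smooth_on U f -> smooth_on U g -> smooth_on U (fun x => (f x, g x)).
Proof. by move=> oU sf sg k; exact: Ck_pair. Qed.

Lemma smooth_inv V (U : set V) (f : V -> R^o) : open U ->
  (forall x, U x -> f x != 0) -> smooth_on U f ->
  smooth_on U (fun x => (f x)^-1 : R^o).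
Proof.
move=> oU f0 sf; apply: (smooth_comp fin_basis_R oU _ f0 sf (@Ck_inv R)).
rewrite (_ : [set _ | _] = ~` [set 0]); first by rewrite openC; exact: closed_eq.
by apply/seteqP; split=> x /eqP.
Qed.

Lemma smooth_sqrt V (U : set V) (f : V -> R^o) : open U ->
  (forall x, U x -> 0 < f x) -> smooth_on U f ->
  smooth_on U (fun x => Num.sqrt (f x) : R^o).
Proof.
move=> oU f0 sf; apply: (smooth_comp fin_basis_R oU _ f0 sf (@Ck_sqrt R)).
exact: open_gt.
Qed.

Lemma smooth_coord V n (U : set V) (f : V -> 'rV[R]_n) j : open U ->
  smooth_on U f -> smooth_on U (fun x => f x ord0 j : R^o).
Proof.
move=> oU.
by apply: (smooth_linear_comp (c := fun w : 'rV[R]_n => w ord0 j : R^o)) => //;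
  [exact: linear_coord|exact: continuous_coord].
Qed.

Lemma smooth_rV V n (U : set V) (f : V -> 'rV[R]_n) : open U ->
  (forall j, smooth_on U (fun x => f x ord0 j : R^o)) -> smooth_on U f.
Proof.
move=> oU sf.
apply: (@smooth_eq _ _ _ (fun x => \sum_j (f x ord0 j : R^o) *: delta_mx 0 j)) => //.
  by move=> x _; rewrite [RHS]row_sum_delta.
by apply: smooth_sum => // j; apply: smooth_scale => //; exact: smooth_cst.
Qed.

(** Base point and vector vary together here, as they do in the transition maps of a tangent
    bundle. *)
Lemma smooth_diff_app V W Z (U : set V) (U' : set W) (f : W -> Z)
    (a b : V -> W) :
  fin_basis W -> open U -> open U' -> (forall x, U x -> U' (a x)) ->
  smooth_on U' f -> smooth_on U a -> smooth_on U b ->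
  smooth_on U (fun x => 'd f (a x) (b x)).
Proof.
move=> bW oU oU' UU' sf sa sb; have [d [e [c [cl ce]]]] := bW.
apply: (@smooth_eq _ _ _ (fun x => \sum_i c i (b x) *: 'd f (a x) (e i))) => //.
  by move=> x _; rewrite [in RHS](ce (b x)) linear_sum; apply: eq_bigr => i _; rewrite linearZ.
apply: smooth_sum => // i; apply: smooth_scale => //.
  by have [lc cc] := cl i; exact: smooth_linear_comp.
exact: (smooth_comp bW oU oU' UU' sa (smooth_diff (e i) sf)).
Qed.

Lemma is_diff_ext V W (f g df dg : V -> W) x :
  is_diff x f df -> f =1 g -> df =1 dg -> is_diff x g dg.
Proof. by move=> H /funext <- /funext <-. Qed.

Lemma line_MVT V (f : V -> R^o) q u (h : R) : 0 < h ->
  (forall s, 0 <= s <= h -> differentiable f (q + s *: u)) ->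
  exists2 s, 0 < s < h & f (q + h *: u) - f q = h * 'd f (q + s *: u) u.
Proof.
move=> h0 df; pose g (s : R) : R := f (q + s *: u).
have dl (s : R) : is_diff (s : R^o) (fun s : R^o => q + s *: u) (fun s => s *: u).
  apply: (is_diff_ext (is_diffD (is_diff_cst q (s : R^o)) (is_diff_scalel s u))) => //.
  by move=> t; rewrite !fctE add0r.
have dg s : 0 <= s <= h -> is_derive s 1 g ('d f (q + s *: u) u).
  move=> sh; have dgs : differentiable (g : R^o -> R^o) s.
    apply: (@differentiable_comp _ _ _ _ (fun s : R^o => q + s *: u) f).
      by have [] := dl s.
    exact: df.
  apply: DeriveDef; first exact/derivable1_diffP.
  rewrite deriveE // -[g]/(f \o (fun s : R^o => q + s *: u)) diff_compE; last 2 first.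
  - by have [] := dl s.
  - exact: df.
  by rewrite (is_diff_val _ (dl s)) scale1r.
have [| |s sh E] := MVT h0 (f := g) (df := fun s => 'd f (q + s *: u) u).
- by move=> s; rewrite in_itv /= => /andP[/ltW ? /ltW ?]; apply: dg; apply/andP.
- apply: derivable_within_continuous => s; rewrite in_itv /= => sh.
  by have [] := dg s sh.
exists s; first by move: sh; rewrite in_itv.
by move: E; rewrite /g scale0r addr0 subr0 mulrC.
Qed.

(** The mean value theorem is applied twice: along [u] to the increment [g] of [f] in the direction
    [v], then along [v] to the derivative of [f] in the direction [u]. *)
Lemma second_difference V (U : set V) (f : V -> R^o) p u v (h : R) :
  0 < h -> smooth_on U f ->
  (forall s t, 0 <= s <= h -> 0 <= t <= h -> U (p + s *: u + t *: v)) ->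
  exists s t, [/\ 0 < s < h, 0 < t < h &
   f (p + h *: u + h *: v) - f (p + h *: u) - (f (p + h *: v) - f p)
     = h * (h * 'd (fun x => 'd f x u) (p + s *: u + t *: v) v)].
Proof.
move=> h0 sf Uh; have h00 : 0 <= (0 : R) <= h by apply/andP; split=> //; exact: ltW.
have hhh : 0 <= h <= h by apply/andP; split=> //; exact: ltW.
pose g x := f (x + h *: v) - f x.
have dsh x : is_diff x (fun x => x + h *: v) id.
  apply: (is_diff_ext (is_diffD (is_diff_id x) (is_diff_cst (h *: v) x))) => //.
  by move=> t; rewrite !fctE addr0.
have Ud x : U x -> differentiable f x := smooth_differentiable sf.
have dg s : 0 <= s <= h -> is_diff (p + s *: u) g
   (fun w => 'd f (p + s *: u + h *: v) w - 'd f (p + s *: u) w).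
  move=> sh.
  have d1 := differentiableP (Ud _ (Uh s h sh hhh)).
  have d2 : is_diff (p + s *: u) f ('d f (p + s *: u)).
    by apply: differentiableP; apply: Ud; have := Uh s 0 sh h00; rewrite scale0r addr0.
  exact: (is_diff_ext (is_diffB (is_diff_comp (dsh _) d1) d2)).
have [|s sh E] := @line_MVT _ g p u h h0.
  by move=> s sh; have [] := dg s sh.
have sh' : 0 <= s <= h by have /andP[/ltW -> /ltW ->] := sh.
have [|t th E'] := @line_MVT _ (fun x => 'd f x u) (p + s *: u) v h h0.
  by move=> t th; apply: smooth_differentiable (smooth_diff u sf) _; exact: Uh.
exists s, t; split=> //.
rewrite -E' -[LHS]/(g (p + h *: u) - g p) E; congr (_ * _).
exact: is_diff_val u (dg s sh').
Qed.

(** The second difference of [f] over a parallelogram is symmetric in [u] and [v], so the two mixed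
    derivatives agree at two points of an arbitrarily small parallelogram; their continuity brings
    both points to [p]. *)
Lemma diff_symmetric V (U : set V) (f : V -> R^o) p u v :
  open U -> U p -> smooth_on U f ->
  'd (fun x => 'd f x u) p v = 'd (fun x => 'd f x v) p u.
Proof.
move=> oU Up sf; apply/eqP; rewrite -subr_eq0 -normr_le0; apply/ler_addgt0Pr => e e0; rewrite add0r.
pose fuv x := 'd (fun x => 'd f x u) x v.
pose fvu x := 'd (fun x => 'd f x v) x u.
have cuv : {for p, continuous fuv}.
  exact: smooth_continuous (smooth_diff v (smooth_diff u sf)) Up.
have cvu : {for p, continuous fvu}.
  exact: smooth_continuous (smooth_diff u (smooth_diff v sf)) Up.
have e20 : 0 < e / 2 by rewrite divr_gt0.
have : \forall x \near p, U x /\ (`|fuv p - fuv x| < e / 2 /\ `|fvu p - fvu x| < e / 2).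
  near=> x; split; first by near: x; exact: open_near.
  by split; near: x; [move/cvgrPdist_lt: cuv; exact|move/cvgrPdist_lt: cvu; exact].
move=> /nbhs_ballP[d /= d0 Hd].
(* With this [h] every point of the parallelogram is within d/2 of [p]; the summand 1 keeps the
   denominator positive when [u] and [v] vanish. *)
pose h := d / (2 * (1 + `|u| + `|v|)).
have uv0 : 0 < 1 + `|u| + `|v| by rewrite -addrA ltr_pwDl // addr_ge0.
have h0 : 0 < h by rewrite divr_gt0 // mulr_gt0.
have hb s t : 0 <= s <= h -> 0 <= t <= h -> ball p d (p + s *: u + t *: v).
  move=> /andP[s0 sh] /andP[t0 th]; rewrite -ball_normE /ball_ /=.
  rewrite -addrA opprD addNKr normrN; apply: le_lt_trans (ler_normD _ _) _.
  rewrite !normrZ !ger0_norm //.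
  apply: (@le_lt_trans _ _ (h * (1 + `|u| + `|v|))).
    rewrite !mulrDr mulr1 -addrA; apply: ler_wpDl; first exact: ltW.
    by apply: lerD; exact: ler_wpM2r.
  rewrite /h invfM mulrA -mulrA mulVf ?gt_eqF // mulr1 ltr_pdivrMr //.
  by rewrite ltr_pMr // ltr1n.
have hU s t : 0 <= s <= h -> 0 <= t <= h -> U (p + s *: u + t *: v).
  by move=> sh th; have [] := Hd _ (hb s t sh th).
have hU' s t : 0 <= s <= h -> 0 <= t <= h -> U (p + s *: v + t *: u).
  by move=> sh th; rewrite addrAC; exact: hU.
have ooW (a : R) : 0 < a < h -> 0 <= a <= h by move=> /andP[/ltW -> /ltW ->].
have [s [t [/ooW sh /ooW th E]]] := second_difference h0 sf hU.
have [s' [t' [/ooW sh' /ooW th' E']]] := second_difference h0 sf hU'.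
have EE : fuv (p + s *: u + t *: v) = fvu (p + s' *: v + t' *: u).
  have hn0 : h != 0 by rewrite gt_eqF.
  apply: (mulfI hn0); apply: (mulfI hn0); rewrite -E -E' (addrAC p (h *: u)).
  by rewrite !opprB addrACA [RHS]addrACA; congr (_ + _); rewrite addrC.
have [_ [B1 _]] := Hd _ (hb s t sh th).
have [_ [_ B2]] := Hd _ (hb t' s' th' sh').
change (`|fuv p - fvu p| <= e).
have -> : fuv p - fvu p = (fuv p - fuv (p + s *: u + t *: v))
    - (fvu p - fvu (p + t' *: u + s' *: v)).
  by rewrite (addrAC p (t' *: u)) -EE opprB addrA subrK.
apply: le_trans (ler_normB _ _) _; rewrite [leRHS]splitr.
by apply: lerD; exact: ltW.
Unshelve. all: by end_near. Qed.

End smooth_facts.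

(** * Exterior powers on a symplectic basis *)

Section wedge_symplectic.
Context {R : realType} {E : normedModType R}.

(** The sum over permutations is reindexed by s -> s * p. *)
Lemma wedge_perm k l (a : altform E k) (b : altform E l) (v : 'I_(k + l) -> E)
    (p : 'S_(k + l)) :
  wedge a b (fun i => v (p i)) = (-1) ^+ p * wedge a b v.
Proof.
rewrite /wedge mulrCA; congr (_ * _).
rewrite [in RHS](reindex_inj (mulIg p)) /= mulr_sumr; apply: eq_bigr => s _.
rewrite odd_permM addbC [RHS]mulrA -signr_addb addbA addbb addFb.
by congr (_ * (a _ * b _)); apply/funext => i; rewrite permM.
Qed.

Lemma lift_perm0_ex n (s : 'S_n.+1) : s ord0 = ord0 ->
  exists s' : 'S_n, s = lift_perm ord0 ord0 s'.
Proof.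
move=> s0; pose f x := odflt x (unlift ord0 (s (lift ord0 x))).
have fE x : s (lift ord0 x) = lift ord0 (f x).
  rewrite /f; case: unliftP => [j -> //|H]; exfalso.
  have : lift ord0 x = ord0 by apply: (@perm_inj _ s); rewrite s0.
  by move/eqP; rewrite eq_sym (negbTE (neq_lift _ _)).
have fI : injective f.
  by move=> x y fxy; apply: (@lift_inj _ ord0); apply: (@perm_inj _ s); rewrite !fE fxy.
exists (perm fI); apply/permP => x; case: (unliftP ord0 x) => [j ->|->].
  by rewrite lift_perm_lift permE fE.
by rewrite lift_perm_id.
Qed.

(* The Gram matrix of a symplectic basis f_0, e_0, f_1, e_1, ... *)
Definition sympl_gram (x y : nat) : R :=
  if x./2 == y./2 then (odd y)%:R - (odd x)%:R else 0.

(** Exchanges the pair {0, 1} with the pair {2i, 2i+1} and keeps parities: a symmetry of the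
    symplectic Gram matrix, by which any pair can be moved to the front. *)
Definition swap_pair (i x : nat) : nat :=
  if x./2 == 0%N then (i.*2 + odd x)%N else if x./2 == i then odd x : nat else x.

Lemma sympl_gram_swap i x y :
  sympl_gram (swap_pair i x) (swap_pair i y) = sympl_gram x y.
Proof.
have od z : odd (swap_pair i z) = odd z.
  by rewrite /swap_pair; case: ifP => ?; [|case: ifP => ?]; lia.
have hf : ((swap_pair i x)./2 == (swap_pair i y)./2) = (x./2 == y./2).
  have half_swap z : (swap_pair i z)./2 =
      if z./2 == 0%N then i else if z./2 == i then 0%N else z./2.
    by rewrite /swap_pair; case: ifP => ?; [|case: ifP => ?]; lia.
  rewrite !half_swap.
  by case: (x./2 =P 0%N) => ?; case: (y./2 =P 0%N) => ?; case: (x./2 =P i) => ?;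
    case: (y./2 =P i) => ?; apply/eqP/eqP; lia.
by rewrite /sympl_gram !od hf.
Qed.

Variables (B : E -> E -> R) (b : altform E 2).
Hypothesis bE : forall w, b w = B (w ord0) (w (lift ord0 ord0)).

Definition symplectic n (v : 'I_n -> E) :=
  forall i j, B (v i) (v j) = sympl_gram i j.

Lemma wedge_exp_perm n (v : 'I_(n * 2) -> E) (p : 'S_(n * 2)) :
  @wedge_exp R E 2 b n (fun i => v (p i)) = (-1) ^+ p * @wedge_exp R E 2 b n v.
Proof.
case: n v p => [|n] v p; last exact: wedge_perm.
have -> : p = 1%g by apply/permP => -[].
by rewrite odd_perm1 mul1r.
Qed.

(** Induction on [n]. A term vanishes unless [s i0] and [s i1] form one symplectic pair. A
    transposition makes [s i0] the even member of that pair, then an even renumbering of the basis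
    moves the pair to the front; what remains is the power [n] of [b] on the other pairs. *)
Lemma wedge_exp_gt0 n (v : 'I_(n * 2) -> E) : symplectic v -> 0 < @wedge_exp R E 2 b n v.
Proof.
elim: n v => [|n IH] v Hv; first exact: ltr01.
pose i0 : 'I_(2 + n * 2) := ord0.
pose i1 : 'I_(2 + n * 2) := lift ord0 (ord0 : 'I_(1 + n * 2)).
pose sh (j : 'I_(n * 2)) : 'I_(2 + n * 2) := lift ord0 (lift ord0 j : 'I_(1 + n * 2)).
pose term (v : 'I_(2 + n * 2) -> E) (s : 'S_(2 + n * 2)) : R :=
  (-1) ^+ s * (B (v (s i0)) (v (s i1)) * @wedge_exp R E 2 b n (fun j => v (s (sh j)))).
have wE : @wedge_exp R E 2 b n.+1 v = ((2`! * (n * 2)`!)%N%:R)^-1 * \sum_s term v s.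
  rewrite /= /wedge; congr (_ * _); apply: eq_bigr => s _; congr (_ * _).
  rewrite bE; congr (B (v (s _)) (v (s _)) * @wedge_exp R E 2 b n _); [exact: val_inj..|].
  by apply/funext => j; congr (v (s _)); exact: val_inj.
have fixed (u : 'I_(2 + n * 2) -> E) (s : 'S_(2 + n * 2)) :
    symplectic u -> s i0 = i0 -> s i1 = i1 -> 0 < term u s.
  move=> Hu s0 s1; have [s' s'E] := lift_perm0_ex s0.
  have s'0 : s' ord0 = ord0.
    apply: (@lift_inj _ ord0); rewrite -[RHS]s1 s'E.
    by rewrite lift_perm_lift.
  have [s'' s''E] := lift_perm0_ex s'0.
  have shE j : s (sh j) = sh (s'' j).
    by rewrite s'E lift_perm_lift s''E lift_perm_lift.
  (* [s] permutes only the later pairs, as [s''] does; its sign cancels the one produced by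
     [wedge_exp_perm]. *)
  have -> : term u s = @wedge_exp R E 2 b n (fun j => u (sh j)).
    rewrite /term s0 s1 Hu {1}s'E s''E !odd_lift_perm /=.
    rewrite (_ : sympl_gram i0 i1 = 1); last by rewrite /sympl_gram /= subr0.
    under eq_fun do rewrite shE.
    rewrite (wedge_exp_perm (fun j => u (sh j))) mul1r mulrA -signr_addb.
    by rewrite addbb mul1r.
  by apply: IH => i j; rewrite Hu /sympl_gram /sh !lift0 /= !negbK eqSS.
(* Both the sign of the permutation and the antisymmetric factor [B] change sign. *)
have swap01 (u : 'I_(2 + n * 2) -> E) (s : 'S_(2 + n * 2)) : symplectic u ->
    term u (tperm i0 i1 * s)%g = term u s.
  move=> Hu; rewrite /term odd_permM odd_tperm /= !permM tpermL tpermR.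
  rewrite !Hu -[sympl_gram (s i1) _]opprK.
  have -> : - sympl_gram (s i1) (s i0) = sympl_gram (s i0) (s i1).
    by rewrite /sympl_gram eq_sym; case: ifP => _; rewrite ?oppr0 ?opprB.
  under eq_fun do rewrite permM tpermD //.
  by rewrite signrN !mulNr mulrN opprK.
have even (u : 'I_(2 + n * 2) -> E) (s : 'S_(2 + n * 2)) :
    symplectic u -> ~~ odd (s i0) -> 0 <= term u s.
  move=> Hu ev.
  have [c0|c0] := eqVneq (sympl_gram (s i0) (s i1)) 0.
    by rewrite /term Hu c0 mul0r mulr0.
  have [hE o1] : (s i0)./2 = (s i1)./2 /\ odd (s i1).
    move: c0; rewrite /sympl_gram (negbTE ev) subr0.
    case: ifP => [/eqP -> c0|]; last by rewrite eqxx.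
    by split=> //; move: c0; case: odd; rewrite ?eqxx.
  have n01 : s i0 != s i1 by apply: contraNneq ev => ->.
  have n0 : i0 != s i1 by apply: contraTneq o1 => <-.
  have n1 : i1 != s i0 by apply: contraNneq ev => <-.
  (* [t] realizes [swap_pair] for the pair of [s i0]. It is either trivial or a product of two
     disjoint transpositions, hence even, so replacing [u] by its composite with the inverse of [t]
     and [s] by [s * t] keeps the term and leads to [fixed]. *)
  pose t := (tperm i0 (s i0) * tperm i1 (s i1))%g.
  have i0E : i0 = 0%N :> nat by [].
  have i1E : i1 = 1%N :> nat by [].
  have tE x : t x = swap_pair (s i0)./2 x :> nat.
    rewrite /t permM /swap_pair.
    case: (tpermP i0 (s i0) x) => [->|->|/eqP x0 /eqP x1].
    - rewrite tpermD //; last by rewrite eq_sym.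
      by move: ev; rewrite i0E /=; lia.
    - rewrite tpermD //; last by rewrite eq_sym.
      by move: ev; rewrite i0E; case: ifP; last case: ifP; lia.
    case: (tpermP i1 (s i1) x) => [->|->|/eqP x2 /eqP x3].
    - by rewrite i1E /=; move: o1 hE; lia.
    - by rewrite i1E; move: o1 hE; case: ifP; last case: ifP; lia.
    have {}x0 : x != 0%N :> nat := x0.
    have {}x1 : x != s i0 :> nat := x1.
    have {}x2 : x != 1%N :> nat := x2.
    have {}x3 : x != s i1 :> nat := x3.
    move: x0 x1 x2 x3 ev o1 hE.
    by case: ifP; last case: ifP; lia.
  have Ht : symplectic (fun x => u (t^-1%g x)).
    move=> x y; rewrite Hu -(sympl_gram_swap (s i0)./2) -!tE.
    by rewrite !permKV.
  have -> : term u s = term (fun x => u (t^-1%g x)) (s * t)%g.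
    have odt : odd_perm t = false.
      rewrite /t odd_permM !odd_tperm -[i0 == _]/(0%N == s i0) -[i1 == _]/(1%N == s i1).
      by move: ev o1 hE; lia.
    have stE x : (t^-1)%g ((s * t)%g x) = s x by rewrite permM permK.
    by rewrite /term odd_permM odt addbF !stE; under [in RHS]eq_fun do rewrite stE.
  apply/ltW/fixed => //; rewrite permM /t permM.
    by rewrite tpermR tpermD // eq_sym.
  by rewrite (tpermD n0 n01) tpermR.
rewrite wE mulr_gt0 ?invr_gt0 ?ltr0n ?muln_gt0 ?fact_gt0 //.
rewrite (bigD1 1%g) //= ltr_pwDl //; first by apply: fixed => //; rewrite perm1.
apply: sumr_ge0 => s _; have [od|ev] := boolP (odd (s i0)); last exact: even.
have [c0|c0] := eqVneq (sympl_gram (s i0) (s i1)) 0.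
  by rewrite /term Hv c0 mul0r mulr0.
(* Two odd members have Gram entry 0, so here [s i1] is even and becomes the first index after the
   swap. *)
rewrite -swap01 //; apply: even => //; rewrite permM tpermL.
by apply: contraNN c0 => od1; rewrite /sympl_gram od od1 subrr if_same.
Qed.

(** [A] kills every vector but the first, so only permutations fixing 0 contribute. Each of these
    gives the same positive number, the sign of [s] being absorbed by [wedge_exp_perm]. *)
Lemma wedge_contact_gt0 n (a : altform E 1) (A : E -> R) (v : 'I_(1 + n * 2) -> E) :
  (forall w, a w = A (w ord0)) -> 0 < A (v ord0) ->
  (forall j : 'I_(n * 2), A (v (lift ord0 j)) = 0) ->
  symplectic (fun j : 'I_(n * 2) => v (lift ord0 j)) ->
  0 < wedge a (@wedge_exp R E 2 b n) v.
Proof.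
move=> aE A0 Av Hv; rewrite /wedge.
rewrite mulr_gt0 ?invr_gt0 ?ltr0n ?muln_gt0 ?fact_gt0 //.
pose term (s : 'S_(1 + n * 2)) : R :=
  (-1) ^+ s * (A (v (s ord0)) * @wedge_exp R E 2 b n (fun j => v (s (lift ord0 j)))).
rewrite (eq_bigr term); last first.
  move=> s _; congr (_ * _); rewrite aE; congr (A (v (s _)) * @wedge_exp R E 2 b n _).
    exact: val_inj.
  by apply/funext => j; congr (v (s _)); exact: val_inj.
have pos (s : 'S_(1 + n * 2)) : s ord0 = ord0 -> 0 < term s.
  move=> s0; have [s' s'E] := lift_perm0_ex s0.
  have sE j : s (lift ord0 j) = lift ord0 (s' j) by rewrite s'E lift_perm_lift.
  rewrite /term s0 {1}s'E odd_lift_perm /= mulrCA; apply: mulr_gt0 => //.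
  under eq_fun do rewrite sE.
  rewrite (wedge_exp_perm (fun j => v (lift ord0 j))) mulrA -signr_addb addbb mul1r.
  exact: wedge_exp_gt0.
rewrite (bigD1 1%g) //= ltr_pwDl //; first by apply: pos; rewrite perm1.
apply: sumr_ge0 => s _.
have [j Hj|H0] := unliftP (ord0 : 'I_(1 + n * 2)) (s ord0); last exact/ltW/pos.
by rewrite /term Hj Av mul0r mulr0.
Qed.

End wedge_symplectic.

(** * Changes of charts *)

Section chart_calculus.
Context {R : realType} {E : normedModType R} (M : atlas E) (hM : smooth_atlas M).
Implicit Types (i j k : chart_index M) (p : M).

Lemma cdom_at p : cdom (chart_at p) p. Proof. by case: hM. Qed.

Lemma chartK i p : cdom i p -> chart_inv i (chart i p) = p.
Proof. by case: hM => _ H _ _; exact: H. Qed.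

Lemma chart_image i (A : set M) x : A `<=` cdom i -> (chart i @` A) x ->
  A (chart_inv i x) /\ chart i (chart_inv i x) = x.
Proof. by move=> Ai [p Ap <-]; rewrite chartK; last exact: Ai. Qed.

Definition overlap i j : set E := chart i @` (cdom i `&` cdom j).

Lemma overlap_open i j : open (overlap i j). Proof. by case: hM => _ _ H _; exact: H. Qed.

Lemma overlap_smooth i j : smooth_on (overlap i j) (chart j \o chart_inv i).
Proof. by case: hM => _ _ _ H; exact: H. Qed.

Lemma overlapP i j x : overlap i j x ->
  [/\ cdom i (chart_inv i x), cdom j (chart_inv i x) & chart i (chart_inv i x) = x].
Proof. by move=> xo; have [[? ?] ?] := chart_image (@subIsetl _ _ _) xo; split. Qed.

Lemma overlap_chart i j p : cdom i p -> cdom j p -> overlap i j (chart i p).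
Proof. by move=> ip jp; exists p. Qed.

Lemma overlap_near i j p : cdom i p -> cdom j p -> \forall x \near chart i p, overlap i j x.
Proof. by move=> ip jp; apply: open_near; [exact: overlap_open|exact: overlap_chart]. Qed.

Lemma overlap_id i : chart i @` cdom i = overlap i i.
Proof. by rewrite /overlap setIid. Qed.

Lemma trans_differentiable i j p : cdom i p -> cdom j p ->
  differentiable (chart j \o chart_inv i) (chart i p).
Proof.
by move=> ip jp; exact: smooth_differentiable (overlap_smooth i j) (overlap_chart ip jp).
Qed.

(** The chain rule through the transition map; the factorization holds only on the overlap of the
    charts, hence near the point. *)
Lemma chart_change (Z : normedModType R) (h : M -> Z) i j p :
  cdom i p -> cdom j p -> differentiable (h \o chart_inv j) (chart j p) ->
  is_diff (chart i p) (h \o chart_inv i)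
    (fun v => 'd (h \o chart_inv j) (chart j p) ('d (chart j \o chart_inv i) (chart i p) v)).
Proof.
move=> ip jp dh; have dt := trans_differentiable ip jp.
have jE : (chart j \o chart_inv i) (chart i p) = chart j p by rewrite /= chartK.
have dh' : differentiable (h \o chart_inv j) ((chart j \o chart_inv i) (chart i p)).
  by rewrite jE.
have H : \forall x \near chart i p,
    ((h \o chart_inv j) \o (chart j \o chart_inv i)) x = (h \o chart_inv i) x.
  near=> x; have /overlapP [_ jx _] : overlap i j x by near: x; exact: overlap_near.
  by rewrite /= chartK.
have := near_is_diff H (differentiable_comp dt dh').
by rewrite (diff_comp dt dh') jE.
Unshelve. all: by end_near. Qed.

Lemma trans_id i p v : cdom i p -> 'd (chart i \o chart_inv i) (chart i p) v = v.
Proof.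
move=> ip; have H : \forall x \near chart i p, id x = (chart i \o chart_inv i) x.
  near=> x; have /overlapP [_ _ xE] : overlap i i x by near: x; exact: overlap_near.
  by rewrite /= xE.
by rewrite (near_diff _ H) // (is_diff_val _ (is_diff_id _)).
Unshelve. all: by end_near. Qed.

(** The case [h := chart k] of [chart_change]. This cocycle rule underlies the later identities
    between [tcoord] and [tvect]. *)
Lemma trans_trans i j k p v : cdom i p -> cdom j p -> cdom k p ->
  'd (chart k \o chart_inv j) (chart j p) ('d (chart j \o chart_inv i) (chart i p) v)
  = 'd (chart k \o chart_inv i) (chart i p) v.
Proof.
move=> ip jp kp.
exact: esym (is_diff_val v (chart_change ip jp (trans_differentiable jp kp))).
Qed.

Lemma tcoord_at p v : tcoord (chart_at p) p v = v.
Proof. by rewrite /tcoord trans_id //; exact: cdom_at. Qed.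

Lemma tvect_at p v : tvect (chart_at p) p v = v.
Proof. by rewrite /tvect trans_id //; exact: cdom_at. Qed.

Lemma tcoord_tvect i j p v : cdom i p -> cdom j p ->
  tcoord j p (tvect i p v) = 'd (chart j \o chart_inv i) (chart i p) v.
Proof. by move=> ip jp; rewrite /tcoord trans_trans //; exact: cdom_at. Qed.

Lemma tvectK i p v : cdom i p -> tcoord i p (tvect i p v) = v.
Proof. by move=> ip; rewrite tcoord_tvect // trans_id. Qed.

Lemma tcoordK i p v : cdom i p -> tvect i p (tcoord i p v) = v.
Proof.
by move=> ip; rewrite /tvect /tcoord trans_trans ?trans_id //; exact: cdom_at.
Qed.

Lemma tcoord_trans i j p v : cdom i p -> cdom j p ->
  'd (chart j \o chart_inv i) (chart i p) (tcoord i p v) = tcoord j p v.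
Proof. by move=> ip jp; rewrite /tcoord trans_trans //; exact: cdom_at. Qed.

Lemma tcoord_linear i p : linear (tcoord i p).
Proof. by move=> a u v; rewrite /tcoord linearP. Qed.

Lemma cdom_open i : open (cdom i : set M).
Proof.
move=> p j ip jp; near=> x.
by have /overlapP [] : overlap j i x by near: x; exact: overlap_near.
Unshelve. all: by end_near. Qed.

Lemma chart_image_open i (A : set M) : open A -> open (chart i @` (A `&` cdom i)).
Proof.
move=> oA; rewrite openE => _ [p [Ap ip] <-]; rewrite /interior; near=> x.
have /overlapP [ix _ xE] : overlap i i x by near: x; exact: overlap_near.
exists (chart_inv i x) => //; split=> //.
by near: x; exact: oA.
Unshelve. all: by end_near. Qed.

End chart_calculus.

Arguments cdom_open {R E M} hM i.

(** * Differentials of smooth maps in arbitrary charts *)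

Section smooth_map_calculus.
Context {R : realType} {E F : normedModType R} (S : atlas F) (M : atlas E).
Hypotheses (hS : smooth_atlas S) (hM : smooth_atlas M).
Variables (f : S -> M) (sf : smooth_map f).
Implicit Types (c : chart_index S) (k : chart_index M) (q : S).

Lemma smooth_map_differentiable c k q : cdom c q -> cdom k (f q) ->
  differentiable (chart k \o f \o chart_inv c) (chart c q).
Proof. by move=> cq kq; have [_ /smooth_differentiable] := sf c k; apply; exists q. Qed.

Lemma smooth_map_near c k q : cdom c q -> cdom k (f q) ->
  \forall x \near chart c q, [/\ cdom c (chart_inv c x), cdom k (f (chart_inv c x)) &
    chart c (chart_inv c x) = x].
Proof.
move=> cq kq; have [oU _] := sf c k; near=> x.
have : (chart c @` (cdom c `&` f @^-1` cdom k)) x.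
  by near: x; apply: open_near => //; exists q.
by move=> /(chart_image hS (@subIsetl _ _ _)) [[]].
Unshelve. all: by end_near. Qed.

(** [differential] is written in the preferred charts; the transition differentials hidden in
    [tcoord] and [tvect] replace these by [k] and [c]. *)
Lemma differential_chart c k q v : cdom c q -> cdom k (f q) ->
  tcoord k (f q) (differential f q (tvect c q v))
  = 'd (chart k \o f \o chart_inv c) (chart c q) v.
Proof.
move=> cq kq; set c0 := chart_at q; set k0 := chart_at (f q).
have c0q : cdom c0 q by exact: cdom_at.
have k0q : cdom k0 (f q) by exact: cdom_at.
rewrite /tcoord /differential /tvect -/c0 -/k0.
have d0 := smooth_map_differentiable c0q k0q.
rewrite -(is_diff_val _ (chart_change hS (h := chart k0 \o f) cq c0q d0)).
have d1 := smooth_map_differentiable cq k0q.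
have fE : (chart k0 \o f \o chart_inv c) (chart c q) = chart k0 (f q).
  by rewrite /= (chartK hS).
have d2 : differentiable (chart k \o chart_inv k0) ((chart k0 \o f \o chart_inv c) (chart c q)).
  by rewrite fE; exact: trans_differentiable.
rewrite -fE; apply: etrans (esym (diff_compE _ d1 d2)) _.
symmetry; apply: near_diff; last exact: differentiable_comp d1 d2.
near=> x; have [cx kx xE] : [/\ cdom c (chart_inv c x), cdom k0 (f (chart_inv c x)) &
    chart c (chart_inv c x) = x] by near: x; exact: smooth_map_near.
by rewrite /= (chartK hM).
Unshelve. all: by end_near. Qed.

End smooth_map_calculus.

(** * The form mu *)

Section tangent_bundle_calculus.
Context {R : realType} {d : nat}.
Local Notation E := 'rV[R]_d.
Variables (M : atlas E) (hM : smooth_atlas M).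
Local Notation TM := (tangent_bundle M).
Implicit Types (i j c : chart_index M) (p : M) (u : TM).
Local Notation pi := (@tproj R E M).
Local Notation tchart i := (@chart R (E * E)%type TM i).
Local Notation tcdom i := (@cdom R (E * E)%type TM i).

Lemma tb_chart_image (A : set M) i : A `<=` cdom i ->
  tchart i @` [set u | A u.1] = [set x | (chart i @` A) x.1].
Proof.
move=> Ai; apply/seteqP; split=> [_ [u Au <-]|[x w] /= [p Ap <-]]; first by exists u.1.
by exists (p, tvect i p w) => //=; rewrite tvectK //; exact: Ai.
Qed.

Lemma tb_image_open (A : set E) : open A -> open [set x : E * E | A x.1].
Proof.
by move=> oA; apply: (@open_comp _ _ (fst : E * E -> E)) => // x _; exact: continuous_fst.
Qed.

Lemma tproj_open (U : set M) : open U -> open (pi @^-1` U).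
Proof.
move=> oU; suff H u i : U u.1 -> cdom i u.1 -> \forall x \near tchart i u, U (chart_inv i x.1).
  by move=> u i; exact: H.
move=> Uu iu; have H : \forall x \near chart i u.1, U (chart_inv i x) := oU u.1 i Uu iu.
exact: (@continuous_fst _ _ _ (tchart i u) _ H).
Qed.

Lemma image_open2 i j (U : set M) : open U ->
  open (chart i @` (U `&` cdom i `&` cdom j)).
Proof.
move=> oU; rewrite -setIA (setIC (cdom i)) setIA; apply: chart_image_open => //.
by apply: openI => //; exact: cdom_open.
Qed.

(** The preferred chart of TM at [u] is induced by that of M at [u.1], and between these two charts
    the projection reads as [fst]. *)
Lemma differential_tproj u X : differential pi u X = X.1.
Proof.
pose c : chart_index M := @chart_at R E M u.1.
rewrite -[LHS]/('d (chart c \o pi \o @chart_inv R (E * E)%type TM c) (tchart c u) X).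
have cu : cdom c u.1 by exact: cdom_at.
have cE : is_diff (tchart c u) (fst : E * E -> E) fst.
  by apply: is_diff_linear; [exact: linear_fst|exact: continuous_fst].
have Hn : \forall x \near tchart c u,
    (fst : E * E -> E) x = (chart c \o pi \o @chart_inv R (E * E)%type TM c) x.
  have H : \forall x \near chart c u.1, overlap c c x by exact: overlap_near.
  near=> x; have /(overlapP hM) [_ _ xE] : overlap c c x.1.
    by near: x; exact: (@continuous_fst _ _ _ (tchart c u)).
  by rewrite /= xE.
have dE : differentiable (fst : E * E -> E) (tchart c u) by case: cE.
by rewrite (near_diff X Hn dE) (is_diff_val X cE).
Unshelve. all: by end_near. Qed.

Lemma vliftE u a : vlift u a = (0, a).
Proof.
rewrite /vlift /velocity /=.
have -> : (fun t : R => (chart (chart_at u.1) u.1,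
      tcoord (chart_at u.1) u.1 (u.2 + t *: a)))
    = (fun t : R => (chart (chart_at u.1) u.1, u.2 + t *: a)).
  by apply/funext => t; rewrite (tcoord_at hM).
have dl (s : R) : is_diff (s : R^o) (fun t : R^o => u.2 + t *: a) (fun t => t *: a).
  apply: (is_diff_ext (is_diffD (is_diff_cst u.2 (s : R^o)) (is_diff_scalel s a))) => //.
  by move=> t; rewrite !fctE add0r.
have df := is_diff_pair (is_diff_cst (chart (chart_at u.1) u.1) (0 : R^o)) (dl 0).
rewrite derive1E deriveE; last by case: df.
by rewrite (is_diff_val _ df) scale1r.
Qed.

Lemma vertical_tbE u X : vertical u X <-> X.1 = 0.
Proof. by rewrite /vertical /= differential_tproj. Qed.

(** In the charts [i] and [j] the section is (x, w) -> d(transition)_x w. *)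
Lemma taut_smooth : smooth_section pi setT (@taut_section R E M).
Proof.
move=> i j; change (chart_index M) in i.
have -> : tchart i @` (setT `&` tcdom i `&` pi @^-1` cdom j)
    = [set x | overlap i j x.1].
  by rewrite setTI; apply: (@tb_chart_image (cdom i `&` cdom j)) => p [].
have oO := @tb_image_open _ (overlap_open hM i j).
apply: (@smooth_eq _ _ _ _ (fun x : E * E => 'd (chart j \o chart_inv i) (x.1 : E) x.2)) => //.
  by move=> x /(overlapP hM) [ix jx xE]; rewrite /= /taut_section /= (tcoord_tvect hM) ?xE.
apply: (smooth_diff_app (fin_basis_rV d) oO (overlap_open hM i j)) => //.
- exact: overlap_smooth.
- by apply: smooth_linear; [exact: linear_fst|exact: continuous_fst].
- by apply: smooth_linear; [exact: linear_snd|exact: continuous_snd].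
Qed.

(** For [e] in the standard basis these are the coordinate fields of the chart [c], the local frame
    in which the tautological section is expanded below. *)
Lemma frame_smooth c (e : E) : smooth_section idfun (cdom c) (fun q : M => tvect c q e).
Proof.
move=> i j; have oU := @image_open2 i j _ (cdom_open hM c).
have UP x : (chart i @` (cdom c `&` cdom i `&` cdom j)) x ->
    [/\ cdom c (chart_inv i x), cdom i (chart_inv i x), cdom j (chart_inv i x) &
     chart i (chart_inv i x) = x].
  move=> xo; have [|[[? ?] ?] ?] := chart_image hM _ xo; last by split.
  by move=> p [[]].
apply: (@smooth_eq _ _ _ _
    (fun x => 'd (chart j \o chart_inv c) ((chart c \o chart_inv i) x) e)) => //.
  by move=> x /UP [cx ix jx xE]; rewrite /= (tcoord_tvect hM).
apply: (smooth_comp (fin_basis_rV d) oU (overlap_open hM c j) _ _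
   (smooth_diff e (overlap_smooth hM c j))).
  by move=> x /UP [cx ix jx xE]; exact: overlap_chart.
apply: smooth_sub (overlap_smooth hM i c) => x [p [[cp ip] jp] <-].
by exists p.
Qed.

Lemma section_tproj (U : set M) (s : M -> E) : open U ->
  smooth_section idfun U s -> smooth_section pi (pi @^-1` U) (s \o pi).
Proof.
move=> oU ss i j.
change (chart_index M) in i.
have -> : tchart i @` (pi @^-1` U `&` tcdom i `&` pi @^-1` cdom j)
    = [set x | (chart i @` (U `&` cdom i `&` cdom j)) x.1].
  by apply: (@tb_chart_image (U `&` cdom i `&` cdom j)) => p [[]].
have oI := @image_open2 i j _ oU.
apply: (smooth_comp (fin_basis_rV d) (tb_image_open oI) oI _ _ (ss i j)) => //.
by apply: smooth_linear; [exact: linear_fst|exact: continuous_fst].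
Qed.

Lemma tb_section_add c (s t : TM -> E) : let U := pi @^-1` cdom c in
  smooth_section pi U s -> smooth_section pi U t ->
  smooth_section pi U (fun u => s u + t u).
Proof.
move=> U ss st i j.
change (chart_index M) in i.
have oI : open (tchart i @` (U `&` tcdom i `&` pi @^-1` cdom j)).
  have -> : tchart i @` (U `&` tcdom i `&` pi @^-1` cdom j)
    = [set x | (chart i @` (cdom c `&` cdom i `&` cdom j)) x.1].
    by apply: (@tb_chart_image (cdom c `&` cdom i `&` cdom j)) => p [[]].
  exact: tb_image_open (@image_open2 i j _ (cdom_open hM c)).
apply: smooth_eq (smooth_add oI (ss i j) (st i j)) => // x _.
pose q : TM := @chart_inv R (E * E)%type TM i x.
by have := tcoord_linear j (pi q) 1 (s q) (t q); rewrite !scale1r.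
Qed.

Lemma tb_section_scale c (h : TM -> R) (s : TM -> E) : let U := pi @^-1` cdom c in
  smooth_fun U h -> smooth_section pi U s -> smooth_section pi U (fun u => h u *: s u).
Proof.
move=> U sh ss i j.
change (chart_index M) in i.
have oI : open (tchart i @` (U `&` tcdom i `&` pi @^-1` cdom j)).
  have -> : tchart i @` (U `&` tcdom i `&` pi @^-1` cdom j)
    = [set x | (chart i @` (cdom c `&` cdom i `&` cdom j)) x.1].
    by apply: (@tb_chart_image (cdom c `&` cdom i `&` cdom j)) => p [[]].
  exact: tb_image_open (@image_open2 i j _ (cdom_open hM c)).
have sh' : smooth_on (tchart i @` (U `&` tcdom i `&` pi @^-1` cdom j))
    (h \o @chart_inv R (E * E)%type TM i : E * E -> R^o).
  by apply: smooth_sub (sh i) => x [u [Uu _] <-]; exists u.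
apply: smooth_eq (smooth_scale oI sh' (ss i j)) => // x _.
by rewrite /tcoord linearZ.
Qed.

Lemma fiber_coord_smooth c (j : 'I_d) :
  smooth_fun (pi @^-1` cdom c) (fun u : TM => tcoord c u.1 u.2 ord0 j).
Proof.
move=> i; change (chart_index M) in i; have -> : tchart i @` (pi @^-1` cdom c `&` tcdom i)
    = [set x | overlap i c x.1].
  by rewrite setIC; apply: (@tb_chart_image (cdom i `&` cdom c)) => p [].
have oO := @tb_image_open _ (overlap_open hM i c).
apply: (@smooth_eq _ _ _ _ (fun x : E * E =>
    'd (chart c \o chart_inv i) (x.1 : E) (x.2 : E) ord0 j : R^o)) => //.
  by move=> x /(overlapP hM) [ix cx xE]; rewrite /= (tcoord_tvect hM) ?xE.
apply: smooth_coord => //.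
apply: (smooth_diff_app (fin_basis_rV d) oO (overlap_open hM i c)) => //.
- exact: overlap_smooth.
- by apply: smooth_linear; [exact: linear_fst|exact: continuous_fst].
- by apply: smooth_linear; [exact: linear_snd|exact: continuous_snd].
Qed.

Lemma dfun_fiber_coord u X (j : 'I_d) :
  dfun (fun u' : TM => tcoord (chart_at u.1) u'.1 u'.2 ord0 j) u X = X.2 ord0 j.
Proof.
pose c : chart_index M := @chart_at R E M u.1.
rewrite -[LHS]/('d ((fun u' : TM => tcoord c u'.1 u'.2 ord0 j)
  \o @chart_inv R (E * E)%type TM c : E * E -> R^o) (tchart c u) X).
have cu : cdom c u.1 by exact: cdom_at.
have cE : is_diff (tchart c u) (fun x : E * E => (x.2 : E) ord0 j : R^o)
    (fun x => (x.2 : E) ord0 j : R^o).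
  apply: is_diff_linear; first by move=> a x y; rewrite /= !mxE.
  move=> x; apply: (@continuous_comp _ _ _ snd (fun w : E => w ord0 j : R^o)).
    exact: continuous_snd.
  exact: continuous_coord.
have Hn : \forall x \near tchart c u, ((x.2 : E) ord0 j : R^o)
    = ((fun u' : TM => tcoord c u'.1 u'.2 ord0 j) \o @chart_inv R (E * E)%type TM c) x.
  have H : \forall x \near chart c u.1, overlap c c x by exact: overlap_near.
  near=> x; have /(overlapP hM) [cx _ xE] : overlap c c x.1.
    by near: x; exact: (@continuous_fst _ _ _ (tchart c u)).
  by rewrite /= (tvectK hM).
have dE : differentiable (fun x : E * E => (x.2 : E) ord0 j : R^o) (tchart c u) by case: cE.
by rewrite (near_diff X Hn dE) (is_diff_val X cE).
Unshelve. all: by end_near. Qed.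

(** * The pull-back connection and the formula for mu *)

Section pullback_connection.
Variables (nabla : M -> E -> (M -> E) -> E) (nablas : TM -> E * E -> (TM -> E) -> E).
Hypotheses (hnabla : connection idfun nabla).
Hypothesis hnablas : pullback_connection pi nabla nablas.

(* Multiplying both sections by the indicator function of [cdom c], which is
   smooth there, makes them equal everywhere. *)
Lemma pullback_connection_local c u X (s t : TM -> E) : let U := pi @^-1` cdom c in
  cdom c u.1 -> smooth_section pi U s -> smooth_section pi U t ->
  (forall u', U u' -> s u' = t u') -> nablas u X s = nablas u X t.
Proof.
move=> U cu ss st stE; have [hc _] := hnablas.
have oU : open U := tproj_open (cdom_open hM c).
have [_ _ leib _] := hc _ oU.
pose chi u' : R := if pselect (U u') then 1 else 0.
have chi1 u' : U u' -> chi u' = 1 by rewrite /chi; case: pselect.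
have schi : smooth_fun U chi.
  move=> i; change (chart_index M) in i.
  have E1 : tchart i @` (U `&` tcdom i) = [set x | overlap i c x.1].
    by rewrite setIC; apply: (@tb_chart_image (cdom i `&` cdom c)) => p [].
  rewrite E1; apply: (@smooth_eq _ _ _ _ (fun=> 1 : R^o)); last exact: smooth_cst.
    exact: tb_image_open (overlap_open hM i c).
  by move=> x /(overlapP hM) [ix cx xE]; rewrite /= chi1.
have dchi : dfun chi u X = 0.
  pose k : chart_index M := @chart_at R E M u.1.
  rewrite -[LHS]/('d (chi \o @chart_inv R (E * E)%type TM k : E * E -> R^o) (tchart k u) X).
  have ku : cdom k u.1 by exact: cdom_at.
  have H : \forall x \near chart k u.1, overlap k c x by exact: overlap_near.
  have Hn : \forall x \near tchart k u,
      cst (1 : R^o) x = (chi \o @chart_inv R (E * E)%type TM k) x.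
    near=> x; have /(overlapP hM) [_ cx _] : overlap k c x.1.
      by near: x; exact: (@continuous_fst _ _ _ (tchart k u)).
    by rewrite /= chi1.
  by rewrite (near_diff X Hn) ?diff_cst //; exact: differentiable_cst.
have chiE s' : smooth_section pi U s' -> nablas u X (fun q => chi q *: s' q) = nablas u X s'.
  by move=> ss'; rewrite leib // dchi scale0r add0r chi1 // scale1r.
rewrite -(chiE s) // -(chiE t) //; congr (nablas u X _); apply/funext => q.
by rewrite /chi; case: pselect => [Uq|nU]; [rewrite stE|rewrite !scale0r].
Unshelve. all: by end_near. Qed.

Lemma connection0 (U : set M) p s : open U -> U p -> smooth_section idfun U s ->
  nabla p 0 s = 0.
Proof.
move=> oU Up ss; have [lin _ _ _] := hnabla oU.
have := lin p s 1 0 0 Up ss; rewrite !scale1r addr0 => /eqP.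
by rewrite -subr_eq subrr eq_sym => /eqP.
Qed.

(** Over a chart the tautological section is a sum of terms [h j *: (s j \o pi)], with [h j] the
    fibre coordinates and [s j] the coordinate fields. The vector (0, a) projects to 0, so the
    pull-back rule kills the derivatives of [s j \o pi], and the Leibniz rule leaves the derivatives
    of the [h j], which are the components of [a]. *)
Lemma nablas_taut_vertical u a : nablas u (0, a) (@taut_section R E M) = a.
Proof.
set c := chart_at u.1; have cu : cdom c u.1 by exact: cdom_at.
pose U : set TM := pi @^-1` cdom c.
have oU : open U := tproj_open (cdom_open hM c).
have [hc hp] := hnablas; have [_ addn leib _] := hc _ oU.
pose h (j : 'I_d) (u' : TM) : R := tcoord c u'.1 u'.2 ord0 j.
pose s (j : 'I_d) (q : M) : E := tvect c q (delta_mx 0 j).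
have ss (j : 'I_d) : smooth_section pi U (s j \o pi).
  exact: section_tproj (cdom_open hM c) (@frame_smooth c _).
have shs (j : 'I_d) : smooth_section pi U (fun u' => h j u' *: (s j \o pi) u').
  by apply: tb_section_scale => //; exact: fiber_coord_smooth.
have stau : smooth_section pi U (@taut_section R E M).
  move=> i j; apply: smooth_sub (taut_smooth i j) => x [u' [[_ iu] ju] <-].
  by exists u'.
(* Smoothness of the partial sums is carried along, since the rules of a connection are available
   for smooth sections only. *)
have Hsum (r : seq 'I_d) : smooth_section pi U
     (fun u' => \sum_(j <- r) h j u' *: (s j \o pi) u') /\
   nablas u (0, a) (fun u' => \sum_(j <- r) h j u' *: (s j \o pi) u')
     = \sum_(j <- r) a ord0 j *: delta_mx 0 j.
  elim: r => [|j r [IH1 IH2]].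
    under eq_fun do rewrite big_nil.
    have s0 : smooth_section pi U (fun=> 0 : E).
      move=> i j; apply: smooth_sub; first exact: subsetT.
      apply: (@smooth_eq _ _ _ _ (fun=> 0 : E)); [exact: openT| |exact: smooth_cst].
      by move=> x _; rewrite /tcoord linear0.
    split=> //; rewrite big_nil.
    have := addn u (0, a) _ _ cu s0 s0; rewrite addr0 => /eqP.
    by rewrite -subr_eq subrr eq_sym => /eqP.
  under eq_fun do rewrite big_cons; split; first exact: tb_section_add.
  rewrite addn // IH2 big_cons leib //; last exact: fiber_coord_smooth.
  rewrite dfun_fiber_coord (hp _ _ _ _ (cdom_open hM c)) //; last exact: frame_smooth.
  rewrite differential_tproj (connection0 (cdom_open hM c)) //; last exact: frame_smooth.
  by rewrite scaler0 addr0 /s /= (tvect_at hM).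
rewrite [RHS]row_sum_delta.
have [Hs <-] := Hsum (index_enum _).
(* The expansion is an identity over the domain of [c] only, so locality of the connection is what
   transfers the value. *)
apply: (pullback_connection_local _ cu stau Hs) => u' Uu'.
rewrite /taut_section -[LHS](tcoordK hM _ Uu') {1}[tcoord c u'.1 u'.2]row_sum_delta.
rewrite /tvect linear_sum; apply: eq_bigr => j _.
by rewrite linearZ.
Qed.

Variable g : M -> E -> E -> R.
Hypothesis hg : riemannian_metric g.

(** [hpart] is a choice, so a candidate must be exhibited: subtract from [X] the vertical vector
    whose component is the derivative of the tautological section along [X]. *)
Lemma hpartP u X : horizontal nablas u (hpart nablas u X) /\ (hpart nablas u X).1 = X.1.
Proof.
have [hc _] := hnablas; have [lin _ _ _] := hc _ openT.
rewrite /hpart; case: xgetP => [Y _ [Yh Yv]|].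
  split=> //; move/vertical_tbE : Yv => /eqP; rewrite /= subr_eq0 => /eqP //.
set w := nablas u X (@taut_section R E M) => /(_ (X - (0, w))) [].
split; last by apply/vertical_tbE; rewrite /= subr0 subrr.
rewrite /horizontal /=.
have -> : X - (0, w) = (-1) *: (0, w) + X by rewrite scaleN1r addrC.
rewrite lin //; last exact: taut_smooth.
by rewrite nablas_taut_vertical scaleN1r addNr.
Qed.

(** [xi] and [theta X] are both vertical, so the horizontal half of the Sasaki metric contributes 0
    and the vertical half pairs [u.2] with the projection of [X]. The rest of the proof sees the
    connection only through this formula. *)
Lemma muE u X : mu g nablas u X = g u.1 u.2 (X ord0).1.
Proof.
have vE a : vlift_inv u (0, a) = a.
  by rewrite /vlift_inv; case: xgetP => [b _|/(_ a)]; rewrite /= vliftE // => -[].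
(* H and V meet in 0: the horizontal part of (0, a) has the form (0, b), and horizontality forces b
   = 0. *)
have hv a : hpart nablas u (0, a) = 0.
  have [] := hpartP u (0, a); case: (hpart _ _ _) => b1 b2 /= + b10.
  by rewrite b10 /horizontal /= nablas_taut_vertical => ->.
rewrite /mu /sasaki /theta /xi !vliftE /vpart !hv !subr0 !vE !differential_tproj.
have [_ gl _ _] := hg.
have -> : g u.1 0 0 = 0.
  have := gl u.1 1 0 0 0; rewrite scale1r addr0 mul1r => /eqP.
  by rewrite -subr_eq subrr => /eqP.
rewrite add0r.
by have [_ ->] := hpartP u (X ord0).
Qed.

End pullback_connection.
End tangent_bundle_calculus.

(** * The contact condition *)

Section local_contact.
Context {R : realType}.

Lemma is_diff_sum (V W : normedModType R) d (f : 'I_d -> V -> W) (df : 'I_d -> V -> W) x :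
  (forall i, is_diff x (f i) (df i)) ->
  is_diff x (fun y => \sum_i f i y) (fun v => \sum_i df i v).
Proof.
move=> H.
suff Hs (s : seq 'I_d) : is_diff x (fun y => \sum_(i <- s) f i y) (fun v => \sum_(i <- s) df i v).
  exact: Hs.
elim: s => [|i s IH].
  by apply: (is_diff_ext (is_diff_cst (0 : W) x)) => y; rewrite big_nil.
by apply: (is_diff_ext (is_diffD (H i) IH)) => y; rewrite big_cons.
Qed.

(** The functions [X j] need not be coordinates: this computes d(sum_j b_j dX_j), where the second
    derivatives of each [X j] cancel. *)
Lemma extd_one_form (V : normedModType R) d (U : set V) (b X : 'I_d -> V -> R^o) p v v' :
  open U -> U p -> (forall j, smooth_on U (b j)) -> (forall j, smooth_on U (X j)) ->
  'd (fun x => \sum_j b j x * 'd (X j) x v' : R^o) p v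
  - 'd (fun x => \sum_j b j x * 'd (X j) x v : R^o) p v'
  = \sum_j ('d (b j) p v * 'd (X j) p v' - 'd (b j) p v' * 'd (X j) p v).
Proof.
move=> oU Up sb sX.
have H w z : 'd (fun x => \sum_j b j x * 'd (X j) x w : R^o) p z =
    \sum_j (b j p * 'd (fun x => 'd (X j) x w) p z + 'd (b j) p z * 'd (X j) p w).
  have Hj j : is_diff p (fun x => b j x * 'd (X j) x w : R^o)
     (fun z => b j p * 'd (fun x => 'd (X j) x w) p z + 'd (b j) p z * 'd (X j) p w : R^o).
    apply: is_diff_scale; first exact: smooth_differentiable (sb j) Up.
    exact: smooth_differentiable (smooth_diff w (sX j)) Up.
  exact: is_diff_val z (is_diff_sum Hj).
apply: etrans (f_equal2 (fun a b => a - b) (H v' v) (H v v')) _.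
rewrite -sumrB; apply: eq_bigr => j _.
have E1 := congr1 (fun t => b j p * t) (diff_symmetric v v' oU Up (sX j)).
by move: E1 => /= ->; rewrite opprD addrACA subrr add0r.
Qed.

End local_contact.

(** * Linear algebra at one point of the hypersurface *)

Section symplectic_frame.
Context {R : realType} (n : nat).
Local Notation E := 'rV[R]_n.+1.
Local Notation N := (2 * n).+1.

Definition dot (a b : E) : R := \sum_j a ord0 j * b ord0 j.

Lemma dotE a b : dot a b = (a *m b^T) ord0 ord0.
Proof. by rewrite mxE; apply: eq_bigr => j _; rewrite !mxE. Qed.

(** [DX], [DW] and [Db] stand for the differentials of base coordinates, fibre coordinates and
    Legendre transform; [w] is the fibre coordinate of the point, [b0] its Legendre transform and
    [G] the Gram matrix of the metric. A vector killed by [DX] is vertical. *)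
Variables (DX DW Db : {linear 'rV[R]_N -> E}) (w b0 : E) (G : 'M[R]_n.+1).
Hypotheses (G_pos : forall z : E, z != 0 -> 0 < dot (z *m G) z).
Hypotheses (w0 : w != 0) (b0E : b0 = w *m G).
Hypothesis Db_vert : forall v, DX v = 0 -> Db v = DW v *m G.
Hypothesis DW_vert : forall v, DX v = 0 -> dot (DW v *m G) w = 0.
Hypothesis D_inj : forall v, DX v = 0 -> DW v = 0 -> v = 0.

(* Counting dimensions: adding the direction [b0] of the Liouville field makes
   the hypersurface fill the whole space. *)
Lemma frame_surj (xi phi : E) :
  exists v t, DX v = xi /\ Db v + t *: b0 = phi.
Proof.
pose L (u : 'rV[R]_(N + 1)) : 'rV[R]_(n.+1 + n.+1) :=
  row_mx (DX (lsubmx u)) (Db (lsubmx u) + rsubmx u ord0 ord0 *: b0).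
have lL : linear L.
  move=> a u u'; rewrite /L !linearP /= !mxE scale_row_mx add_row_mx.
  by congr row_mx; rewrite scalerDr scalerDl scalerA addrACA.
pose LM := GRing.isLinear.Build _ _ _ _ _ lL.
pose LL : {linear 'rV[R]_(N + 1) -> 'rV[R]_(n.+1 + n.+1)} := HB.pack L LM.
pose A := lin1_mx LL.
have AE u : u *m A = L u by rewrite mul_rV_lin1.
have fA : row_free A.
  apply: inj_row_free => u; rewrite AE /L -[0]row_mx0 => /eq_row_mx [].
  set v := lsubmx u; set t := rsubmx u ord0 ord0 => HX Hb.
  (* On the kernel [v] is vertical, so the second block equals (DW v + t w) G. Positivity of [G]
     gives DW v = - t w, and pairing with [w] through [G] forces t = 0, since vertical tangent
     vectors are orthogonal to the radial direction. *)
  have HG : (DW v + t *: w) *m G = 0.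
    by rewrite mulmxDl -scalemxAl -b0E -Db_vert.
  have HW : DW v + t *: w = 0.
    apply/eqP; apply: contraT => /G_pos; rewrite HG /dot big1 ?ltxx // => j _.
    by rewrite mxE mul0r.
  have t0 : t = 0.
    have := DW_vert HX; rewrite -[DW v](addrK (t *: w)) HW sub0r mulNmx -scalemxAl.
    move=> /eqP; rewrite dotE mulNmx -scalemxAl !mxE -/(dot _ _) oppr_eq0 mulf_eq0.
    case/orP => [/eqP //|]; have := G_pos w0; rewrite dotE mxE => H /eqP H0.
    by rewrite H0 ltxx in H.
  have v0 : v = 0.
    by apply: D_inj => //; move: HW; rewrite t0 scale0r addr0.
  rewrite -[u]hsubmxK -/v v0 (_ : rsubmx u = 0) ?row_mx0 //.
  by apply/rowP => j; rewrite ord1 [RHS]mxE; exact: t0.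
(* Source and target both have dimension 2n+2, so the injective map is onto. *)
have FA : row_full A.
  by rewrite /row_full; move: fA => /eqP ->; apply/eqP; lia.
have /submxP [u uE] := submx_full (row_mx xi phi) FA.
exists (lsubmx u), (rsubmx u ord0 ord0).
by move: uE; rewrite AE /L => /eq_row_mx [-> ->].
Qed.

Definition frame_form (v v' : 'rV[R]_N) : R := dot (Db v) (DX v') - dot (Db v') (DX v).

(** [frame_surj] prescribes [DX v] freely and [Db v] up to a multiple of [b0]. When all the [DX v]
    are taken orthogonal to [b0], such multiples do not contribute to [frame_form], so it suffices
    to choose dual families. *)
Lemma symplectic_frame_ex : exists v : 'I_(1 + n * 2) -> 'rV[R]_N,
  [/\ 0 < dot b0 (DX (v ord0)),
      forall j : 'I_(n * 2), dot b0 (DX (v (lift ord0 j))) = 0 &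
      symplectic frame_form (fun j : 'I_(n * 2) => v (lift ord0 j))].
Proof.
have b00 : b0 != 0.
  apply/eqP => b00; have := G_pos w0; rewrite -b0E b00 /dot big1 ?ltxx // => j _.
  by rewrite mxE mul0r.
have [k bk] : exists k, b0 ord0 k != 0.
  apply/existsP; apply: contraR b00 => /existsPn H.
  by apply/eqP/rowP => j; rewrite mxE; apply/eqP/negPn.
have half_lt (j : 'I_(n * 2)) : (j./2 < n)%N by have := ltn_ord j; lia.
pose l (j : 'I_(n * 2)) : 'I_n.+1 := lift k (Ordinal (half_lt j)).
have lk j : (l j == k) = false by apply/negbTE; rewrite eq_sym neq_lift.
have ll i j : (l i == l j) = (i./2 == j./2) by rewrite (inj_eq lift_inj).
(* Even indices move the momentum only, odd indices the position only. The position vectors are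
   corrected along a coordinate [k] where [b0] does not vanish, which places them in the hyperplane
   orthogonal to [b0]; [l] runs through the other coordinates. *)
pose phi (j : 'I_(n * 2)) : E := if odd j then 0 else delta_mx 0 (l j).
pose xi (j : 'I_(n * 2)) : E :=
  if odd j then delta_mx 0 (l j) - (b0 ord0 (l j) / b0 ord0 k) *: delta_mx 0 k else 0.
have [V [T HVT]] : exists V T, forall j, DX (V j) = xi j /\ Db (V j) + T j *: b0 = phi j.
  have H j := frame_surj (xi j) (phi j).
  exists (fun j => projT1 (cid (H j))), (fun j => projT1 (cid (projT2 (cid (H j))))) => j.
  exact: projT2 (cid (projT2 (cid (H j)))).
(* Any vector over [w] serves as the first one: on it the contact form equals the squared norm of
   [w]. *)
have [v0 [t0 [Hv0 _]]] := frame_surj w 0.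
exists (fun i => if unlift ord0 i is Some j then V j else v0).
have dot_delta (a : E) i : dot a (delta_mx 0 i) = a ord0 i.
  rewrite /dot (bigD1 i) //= mxE !eqxx mulr1 big1 ?addr0 // => m mi.
  by rewrite mxE (negbTE mi) andbF mulr0.
have dotBr (a x y : E) (c : R) : dot a (x - c *: y) = dot a x - c * dot a y.
  rewrite /dot mulr_sumr -sumrB; apply: eq_bigr => m _.
  by rewrite !mxE mulrBr mulrCA.
have dot0r (a : E) : dot a 0 = 0 by rewrite /dot big1 // => m _; rewrite mxE mulr0.
have dot0l (a : E) : dot 0 a = 0 by rewrite /dot big1 // => m _; rewrite mxE mul0r.
have b0xi j : dot b0 (xi j) = 0.
  by rewrite /xi; case: odd => //; rewrite dotBr !dot_delta mulfVK ?subrr.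
split.
- by rewrite unlift_none Hv0 b0E G_pos.
- by move=> j; rewrite liftK; have [-> _] := HVT j.
move=> i j; rewrite !liftK /frame_form.
(* The unknown multiple [T m *: b0] drops out because [b0] is orthogonal to every [xi]. *)
have DbE m m' : dot (Db (V m)) (DX (V m')) = dot (phi m) (xi m').
  have [_ <-] := HVT m; have [-> _] := HVT m'.
  rewrite [in RHS]/dot; under [RHS]eq_bigr do rewrite !mxE mulrDl -mulrA.
  by rewrite big_split /= -mulr_sumr -/(dot b0 _) b0xi mulr0 addr0.
have phixi m m' : dot (phi m) (xi m') = if ~~ odd m && odd m' then (m./2 == m'./2)%:R else 0.
  rewrite /phi /xi; case: (odd m); rewrite ?dot0l //=; case: (odd m'); rewrite ?dot0r //=.
  by rewrite dotBr !dot_delta !mxE !eqxx /= eq_sym ll (eq_sym k) lk mulr0 subr0.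
rewrite !DbE !phixi /sympl_gram (eq_sym j./2).
by case: (odd i); case: (odd j); case: eqP => _ /=; rewrite ?subr0 ?sub0r ?subrr ?oppr0.
Qed.

End symplectic_frame.

(** * The metric in coordinates *)

Section metric_coordinates.
Context {R : realType} {d : nat}.
Local Notation E := 'rV[R]_d.
Variables (M : atlas E) (hM : smooth_atlas M) (g : M -> E -> E -> R).
Hypothesis hg : riemannian_metric g.

Definition gram (k : chart_index M) (p : M) : 'M[R]_d :=
  \matrix_(i, j) g p (tvect k p (delta_mx 0 i)) (tvect k p (delta_mx 0 j)).

Lemma metric0l p v : g p 0 v = 0.
Proof.
have [_ gl _ _] := hg; have := gl p 1 0 0 v; rewrite scale1r addr0 mul1r => /eqP.
by rewrite -subr_eq subrr => /eqP.
Qed.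

Lemma metric_suml p I (s : seq I) (a : I -> R) (e : I -> E) v :
  g p (\sum_(i <- s) a i *: e i) v = \sum_(i <- s) a i * g p (e i) v.
Proof.
have [_ gl _ _] := hg; elim: s => [|i s IH]; first by rewrite !big_nil metric0l.
by rewrite !big_cons gl IH.
Qed.

Lemma metric_sumr p I (s : seq I) (a : I -> R) (e : I -> E) v :
  g p v (\sum_(i <- s) a i *: e i) = \sum_(i <- s) a i * g p v (e i).
Proof.
have [gs _ _ _] := hg; rewrite gs metric_suml.
by apply: eq_bigr => i _; rewrite gs.
Qed.

Lemma metricZZ p a v : g p (a *: v) (a *: v) = a ^+ 2 * g p v v.
Proof.
have := metric_suml p [:: tt] (fun=> a) (fun=> v) (a *: v); rewrite !big_seq1 => ->.
have := metric_sumr p [:: tt] (fun=> a) (fun=> v) v; rewrite !big_seq1 => ->.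
by rewrite mulrA expr2.
Qed.

Lemma metric_ge0 p v : 0 <= g p v v.
Proof.
have [_ _ gpos _] := hg; have [->|/gpos/ltW//] := eqVneq v 0.
by rewrite metric0l.
Qed.

Lemma tvect_row (k : chart_index M) (p : M) (x : E) :
  tvect k p x = \sum_j x ord0 j *: tvect k p (delta_mx 0 j).
Proof.
by rewrite {1}[x]row_sum_delta /tvect linear_sum; apply: eq_bigr => j _; rewrite linearZ.
Qed.

Lemma metric_gram (k : chart_index M) (p : M) (x y : E) :
  g p (tvect k p x) (tvect k p y) = \sum_j (x *m gram k p) ord0 j * y ord0 j.
Proof.
rewrite (tvect_row k p x) metric_suml.
under eq_bigr do rewrite (tvect_row k p y) metric_sumr mulr_sumr.
rewrite exchange_big; apply: eq_bigr => j _; rewrite mxE mulr_suml.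
by apply: eq_bigr => i _; rewrite !mxE mulrA mulrAC.
Qed.

Lemma gram_sym k p : (gram k p)^T = gram k p.
Proof. by have [gs _ _ _] := hg; apply/matrixP => i j; rewrite !mxE gs. Qed.

Lemma gram_smooth (k : chart_index M) i j :
  smooth_on (chart k @` cdom k) (fun x : E => gram k (chart_inv k x) i j : R^o).
Proof.
have [_ _ _ gsm] := hg.
apply: smooth_eq (gsm k (delta_mx 0 i) (delta_mx 0 j)); last by move=> x _; rewrite [RHS]mxE.
by rewrite overlap_id; exact: overlap_open.
Qed.

End metric_coordinates.

Lemma diff_coord (R : realType) (V : normedModType R) d (f : V -> 'rV[R]_d) x v j :
  differentiable f x -> 'd f x v ord0 j = 'd (fun y => f y ord0 j : R^o) x v.
Proof.
move=> df.
have dc := is_diff_linear (f x) (@linear_coord R d j) (@continuous_coord R d j).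
rewrite -[in RHS]/((fun w : 'rV[R]_d => w ord0 j : R^o) \o f) [RHS]diff_compE //.
by rewrite (is_diff_val _ dc).
Qed.

(** * Differentials on the hypersurface in one chart *)

Section local_hypersurface.
Context {R : realType} {n : nat}.
Local Notation E := 'rV[R]_n.+1.
Local Notation F := 'rV[R]_(2 * n).+1.
(** [U] plays the image of a chart of S_rM and [K] that of a chart of M; [rho] is the square of [r],
    and [quadE] below is the equation of the sphere bundle, squared to stay smooth. *)
Variables (U : set F) (K : set E) (X W : F -> E) (G : E -> 'M[R]_n.+1) (rho : E -> R^o).
Variable phi : F.
Hypotheses (oU : open U) (Uphi : U phi) (oK : open K) (XK : forall x, U x -> K (X x)).
Hypotheses (sX : smooth_on U X) (sW : smooth_on U W).
Hypothesis sG : forall i j, smooth_on K (fun y : E => G y i j : R^o).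
Hypothesis srho : smooth_on K rho.
Hypothesis quadE : forall x, U x -> dot (W x *m G (X x)) (W x) = rho (X x).
Hypothesis G_sym : (G (X phi))^T = G (X phi).

Definition legendre (x : F) : E := W x *m G (X x).

Lemma legendre_smooth : smooth_on U legendre.
Proof.
apply: smooth_rV => // j.
apply: (@smooth_eq _ _ _ _ (fun x => \sum_i W x ord0 i * G (X x) i j : R^o)) => //.
  by move=> x _; rewrite mxE.
apply: smooth_sum => // i; apply: smooth_mul => //; first exact: smooth_coord.
exact: (smooth_comp (fin_basis_rV _) oU oK XK sX (sG i j)).
Qed.

Let Xd := smooth_differentiable sX Uphi.
Let Wd := smooth_differentiable sW Uphi.
Let bd := smooth_differentiable legendre_smooth Uphi.

Lemma diff_comp_vertical (h : E -> R^o) v : smooth_on K h -> 'd X phi v = 0 ->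
  'd (h \o X) phi v = 0.
Proof.
move=> sh Xv; rewrite diff_compE //; first by rewrite Xv linear0.
exact: smooth_differentiable sh (XK Uphi).
Qed.

(** Product rule: the derivative of [G \o X] factors through ['d X] and vanishes on vertical
    vectors. *)
Lemma diff_legendre_vertical v : 'd X phi v = 0 ->
  'd legendre phi v = 'd W phi v *m G (X phi).
Proof.
move=> Xv; apply/rowP => j; rewrite (diff_coord _ _ bd).
have Hi i : is_diff phi (fun x => W x ord0 i * G (X x) i j : R^o)
   (fun v => W phi ord0 i * 'd (fun x => G (X x) i j : R^o) phi v
           + 'd (fun x => W x ord0 i : R^o) phi v * G (X phi) i j : R^o).
  apply: is_diff_scale; first exact: smooth_differentiable (smooth_coord i oU sW) Uphi.
  apply: (@differentiable_comp _ _ _ _ X (fun y => G y i j : R^o)) => //.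
  exact: smooth_differentiable (sG i j) (XK Uphi).
have -> : (fun x => legendre x ord0 j : R^o) = (fun x => \sum_i W x ord0 i * G (X x) i j).
  by apply/funext => x; rewrite mxE.
rewrite (is_diff_val v (is_diff_sum Hi)) mxE; apply: eq_bigr => i _.
rewrite [X in _ * X + _](diff_comp_vertical (sG i j) Xv) mulr0 add0r.
by congr (_ * _); symmetry; exact: diff_coord.
Qed.

(** The sphere equation is differentiated along [v]: its right side depends on [X] only, and by
    symmetry of [G] its left side has derivative twice this pairing. *)
Lemma diff_fiber_vertical v : 'd X phi v = 0 ->
  dot ('d W phi v *m G (X phi)) (W phi) = 0.
Proof.
move=> Xv.
have H1 : 'd (fun x => dot (legendre x) (W x) : R^o) phi v = 0.
  have Hn : \forall x \near phi, (rho \o X) x = (dot (legendre x) (W x) : R^o).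
    by near=> x; rewrite quadE //; near: x; exact: (open_near oU Uphi).
  rewrite (near_diff v Hn) ?(diff_comp_vertical srho Xv) //.
  apply: differentiable_comp => //.
  exact: smooth_differentiable srho (XK Uphi).
have Hi i : is_diff phi (fun x => legendre x ord0 i * W x ord0 i : R^o)
   (fun v => legendre phi ord0 i * 'd (fun x => W x ord0 i : R^o) phi v
           + 'd (fun x => legendre x ord0 i : R^o) phi v * W phi ord0 i : R^o).
  apply: is_diff_scale; last exact: smooth_differentiable (smooth_coord i oU sW) Uphi.
  exact: smooth_differentiable (smooth_coord i oU legendre_smooth) Uphi.
have H2 : \sum_i (legendre phi ord0 i * 'd W phi v ord0 i
    + 'd legendre phi v ord0 i * W phi ord0 i) = 0.
  rewrite -[RHS]H1 [RHS](is_diff_val v (is_diff_sum Hi)); apply: eq_bigr => i _.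
  by congr (_ * _ + _ * _); exact: diff_coord.
have : dot (legendre phi) ('d W phi v) + dot ('d W phi v *m G (X phi)) (W phi) = 0.
  by rewrite -(diff_legendre_vertical Xv) -[RHS]H2 big_split.
have -> : dot (legendre phi) ('d W phi v) = dot ('d W phi v *m G (X phi)) (W phi).
  rewrite !dotE -[in LHS](trmxK (_ *m _)) mxE !trmx_mul trmxK.
  by rewrite G_sym mulmxA.
by move=> /eqP; rewrite -mulr2n mulrn_eq0 /= => /eqP.
Unshelve. all: by end_near. Qed.

(** Differentiability is recorded because [extd] is written with directional derivatives, and
    [deriveE] needs it to pass to differentials. *)
Lemma exterior_derivative v v' :
  let h v x : R^o := \sum_j legendre x ord0 j * 'd (fun x => X x ord0 j : R^o) x v in
  (forall v, differentiable (h v) phi) /\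
  'd (h v') phi v - 'd (h v) phi v' = frame_form ('d X phi) ('d legendre phi) v v'.
Proof.
move=> h; have sb (j : 'I_n.+1) : smooth_on U (fun x : F => legendre x ord0 j : R^o).
  by apply: smooth_coord => //; exact: legendre_smooth.
have sXj (j : 'I_n.+1) : smooth_on U (fun x : F => X x ord0 j : R^o) by exact: smooth_coord.
split.
  move=> w; apply: (smooth_differentiable (U := U)) => //.
  apply: smooth_sum => // j; apply: smooth_mul => //.
  exact: smooth_diff (sXj j).
rewrite (extd_one_form (U := U) (b := fun j x => legendre x ord0 j)
  (X := fun j x => X x ord0 j)) //.
rewrite /frame_form /dot -sumrB; apply: eq_bigr => j _.
by congr (_ * _ - _ * _); symmetry; apply: diff_coord.
Qed.

End local_hypersurface.

(** * The contact condition at a point of an embedded sphere bundle *)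

Section contact.
Context {R : realType} {n : nat}.
Local Notation E := 'rV[R]_n.+1.
Local Notation F := 'rV[R]_(2 * n).+1.
Variables (M : atlas E) (hM : smooth_atlas M) (g : M -> E -> E -> R).
Hypothesis hg : riemannian_metric g.
Variables (r : M -> R) (hr : smooth_fun setT r) (hr0 : forall p, 0 < r p).
Local Notation TM := (tangent_bundle M).
Local Notation tchart i := (@chart R (E * E)%type TM i).
Variables (S : atlas F) (iota : S -> TM).
Hypothesis iota_emb : submanifold_embedding iota (sphere_bundle g r).

Let hS : smooth_atlas S. Proof. by case: iota_emb. Qed.
Let siota : smooth_map iota. Proof. by case: iota_emb. Qed.
Let f : S -> M := @tproj R E M \o iota.

Lemma base_smooth : smooth_map f.
Proof.
move=> i j; have [oU sU] := siota i j; split=> //.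
exact: (smooth_linear_comp (@linear_fst R E E) (@continuous_fst R E E) oU sU).
Qed.

Lemma differential_base q v : (differential iota q v).1 = differential f q v.
Proof.
have cq : cdom (chart_at q) q by exact: cdom_at.
have kq : @cdom R _ TM (chart_at (iota q)) (iota q) by exact: (@cdom_at _ _ M hM (iota q).1).
have dF := smooth_map_differentiable siota cq kq.
set x := chart _ q in dF.
have dc := is_diff_linear ((chart (chart_at (iota q)) \o iota \o chart_inv (chart_at q)) x)
  (@linear_fst R E E) (@continuous_fst R E E).
rewrite -[RHS]/('d ((fst : E * E -> E) \o
   (tchart (chart_at (iota q)) \o iota \o chart_inv (chart_at q))) x v).
rewrite [RHS]diff_compE //.
by rewrite (is_diff_val _ dc).
Qed.

Section at_point.
Variable (p : S).
Let c : chart_index S := chart_at p.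
Let k : chart_index M := @chart_at R E M (iota p).1.
Let U : set F := chart c @` (cdom c `&` f @^-1` cdom k).
Let phi : F := chart c p.
Let X : F -> E := chart k \o f \o chart_inv c.
(** The chart [k] stays fixed near [p]: the components stored in [iota] refer to a preferred chart
    that may jump from point to point. *)
Let W : F -> E := fun x => tcoord k (f (chart_inv c x)) (iota (chart_inv c x)).2.
Let G (y : E) : 'M[R]_n.+1 := gram g k (chart_inv k y).
Local Notation beta := (legendre X W G).

Let cp : cdom c p. Proof. exact: cdom_at. Qed.
Let kp : cdom k (f p). Proof. exact: cdom_at. Qed.
Let oU : open U. Proof. by have [] := base_smooth c k. Qed.
Let Uphi : U phi. Proof. by exists p. Qed.
Let sX : smooth_on U X. Proof. by have [] := base_smooth c k. Qed.

Let UP x : U x -> [/\ cdom c (chart_inv c x), cdom k (f (chart_inv c x)) &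
  chart c (chart_inv c x) = x].
Proof. by move=> Ux; have [[? ?] ?] := chart_image hS (@subIsetl _ _ _) Ux; split. Qed.

Let sW : smooth_on U W.
Proof.
have [_ sF] := siota c k.
exact: (smooth_linear_comp (@linear_snd R E E) (@continuous_snd R E E) oU sF).
Qed.

Let oK : open (chart k @` cdom k).
Proof. by rewrite overlap_id; exact: overlap_open. Qed.

Let XK x : U x -> (chart k @` cdom k) (X x).
Proof. by move=> /UP [_ kx _]; exists (f (chart_inv c x)). Qed.

Let betaE x : U x -> beta x = W x *m gram g k (f (chart_inv c x)).
Proof. by move=> /UP [_ kx _]; rewrite /legendre /G /X /= (chartK hM). Qed.

(** Stands for [mu], known only through the formula of [muE]. *)
Variable a : dform TM 1.
Hypothesis aE : forall u Y, a u Y = g u.1 u.2 (Y ord0).1.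

Let alphaE x v : U x ->
  pullback iota a (chart_inv c x) (fun=> tvect c (chart_inv c x) v)
  = \sum_j beta x ord0 j * 'd (fun x => X x ord0 j : R^o) x v.
Proof.
move=> Ux; have [cx kx xE] := UP Ux; rewrite /pullback aE differential_base.
set q := chart_inv c x.
have -> : (iota q).2 = tvect k (f q) (W x) by rewrite /W tcoordK.
rewrite -[differential f q _](tcoordK hM _ kx) (differential_chart hS hM base_smooth) //.
rewrite (metric_gram hg) -betaE // xE; apply: eq_bigr => j _.
by rewrite diff_coord //; exact: smooth_differentiable sX _.
Qed.

Let sG i j : smooth_on (chart k @` cdom k) (fun y : E => G y i j : R^o).
Proof. exact: gram_smooth. Qed.

Let extdE w : extd (pullback iota a) p w
  = frame_form ('d X phi) ('d beta phi) (w ord0) (w (lift ord0 ord0)).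
Proof.
have [hd hE] := exterior_derivative oU Uphi oK XK sX sW sG (w ord0) (w (lift ord0 ord0)).
rewrite -[RHS]hE.
have dE v v' : 'D_v (fun x : F => pullback iota a (chart_inv c x)
      (fun=> tvect c (chart_inv c x) v') : R^o) phi =
    'd (fun x => \sum_j beta x ord0 j * 'd (fun x => X x ord0 j : R^o) x v' : R^o) phi v.
  rewrite -(deriveE _ (hd v')); apply: near_eq_derive.
  near=> x; apply: alphaE; near: x; exact: (open_near oU Uphi).
rewrite /extd -/c big_ord_recl big_ord1 expr0 mul1r expr1 mulN1r.
have -> : (fun x : F => pullback iota a (chart_inv c x)
      (fun j => tvect c (chart_inv c x) (w (lift ord0 j)))) =
   (fun x : F => pullback iota a (chart_inv c x)
      (fun=> tvect c (chart_inv c x) (w (lift ord0 ord0)))).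
  by apply/funext => x; congr (pullback _ _ _ _); apply/funext => j; rewrite ord1.
have -> : (fun x : F => pullback iota a (chart_inv c x)
      (fun j => tvect c (chart_inv c x) (w (lift (lift ord0 ord0) j)))) =
   (fun x : F => pullback iota a (chart_inv c x)
      (fun=> tvect c (chart_inv c x) (w ord0))).
  apply/funext => x; congr (pullback _ _ _ _); apply/funext => j.
  by have -> : lift (lift ord0 ord0) j = ord0 by apply: val_inj; rewrite (ord1 j).
by rewrite !dE.
Unshelve. all: by end_near. Qed.

Let sphereE q : g (f q) (iota q).2 (iota q).2 = r (f q) ^+ 2.
Proof.
have [_ _ _ [_ rg] _] := iota_emb.
have H : sphere_bundle g r (iota q) by rewrite -rg; exists q.
have H' : Num.sqrt (g (f q) (iota q).2 (iota q).2) = r (f q) := H.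
have H0 := metric_ge0 hg (f q) (iota q).2.
exact: etrans (esym (sqr_sqrtr H0)) (congr1 (fun t => t ^+ 2) H').
Qed.

Let quadE x : U x -> dot (W x *m G (X x)) (W x) = r (chart_inv k (X x)) ^+ 2.
Proof.
move=> Ux; have [cx kx xE] := UP Ux.
have WE : tvect k (f (chart_inv c x)) (W x) = (iota (chart_inv c x)).2 := tcoordK hM _ kx.
have XE : chart_inv k (X x) = f (chart_inv c x) := chartK hM kx.
set q := chart_inv c x in WE XE.
have GE : G (X x) = gram g k (f q) := congr1 (gram g k) XE.
transitivity (g (f q) (iota q).2 (iota q).2).
  exact: (etrans (congr1 (fun A => dot (W x *m A) (W x)) GE)
    (etrans (esym (metric_gram hg k (f q) (W x) (W x))) (f_equal2 (g (f q)) WE WE))).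
exact: (etrans (sphereE q) (congr1 (fun b => r b ^+ 2) (esym XE))).
Qed.

Let rho (y : E) : R^o := r (chart_inv k y) ^+ 2.

Let srho : smooth_on (chart k @` cdom k) rho.
Proof.
have sr : smooth_on (chart k @` cdom k) (r \o chart_inv k : E -> R^o).
  by have := hr k; rewrite setTI.
by apply: smooth_eq (smooth_mul oK sr sr) => // x _; rewrite /rho expr2.
Qed.

Let G_sym : (G (X phi))^T = G (X phi). Proof. exact: gram_sym. Qed.

(** The pair (X, W) is [iota] read in the preferred charts, so this is the immersion property. *)
Let D_inj v : 'd X phi v = 0 -> 'd W phi v = 0 -> v = 0.
Proof.
move=> Xv Wv; have [_ _ inj _ _] := iota_emb; apply: (inj p).
have dXW : 'd (fun x => (X x, W x)) phi v = 0.
  have E1 := diff_pair (smooth_differentiable sX Uphi) (smooth_differentiable sW Uphi).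
  exact: etrans (congr1 (fun h => h v) E1) (f_equal2 pair Xv Wv).
have d0 : differential iota p 0 = 0 by rewrite /differential linear0.
exact: etrans (dXW : differential iota p v = 0) (esym d0).
Qed.

Lemma contact_at_point : exists v,
  wedge (pullback iota a p) (@wedge_exp R F 2 (extd (pullback iota a) p) n) v != 0.
Proof.
have ip : chart_inv c phi = p := chartK hS cp.
have Xphi : chart_inv k (X phi) = f p :=
  etrans (congr1 (fun q => chart_inv k (chart k (f q))) ip) (chartK hM kp).
have Gpos (z : E) : z != 0 -> 0 < dot (z *m G (X phi)) z.
  move=> z0; have pos : 0 < g (f p) (tvect k (f p) z) (tvect k (f p) z).
    have [_ _ gpos _] := hg; apply: gpos; apply: contra_neq z0 => H.
    by rewrite -(tvectK hM z kp) H /tcoord linear0.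
  have E1 := etrans (metric_gram hg k (f p) z z)
    (congr1 (fun q => dot (z *m gram g k q) z) (esym Xphi)).
  exact: (eq_ind _ (fun t => 0 < t) pos _ E1).
(* The zero section is avoided because [r] is positive. *)
have w0 : W phi != 0.
  apply/eqP => W0.
  have rn0 : r (chart_inv k (X phi)) ^+ 2 != 0 by rewrite sqrf_eq0 gt_eqF.
  have D0 : dot (W phi *m G (X phi)) 0 = 0.
    by rewrite /dot big1 // => j _; rewrite [X in _ * X]mxE mulr0.
  apply: (negP rn0); apply/eqP; apply: etrans D0.
  exact: etrans (esym (quadE Uphi)) (congr1 (dot (W phi *m G (X phi))) W0).
have [v [v0 vt vs]] := symplectic_frame_ex Gpos w0 (erefl (beta phi))
  (diff_legendre_vertical oU Uphi oK XK sX sW sG)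
  (diff_fiber_vertical oU Uphi oK XK sX sW sG srho quadE G_sym) D_inj.
have pE w : pullback iota a p w = dot (beta phi) ('d X phi (w ord0)).
  have E1 := alphaE (w ord0) Uphi; rewrite ip (tvect_at hS) in E1.
  have E2 : (fun=> w ord0) = w by apply/funext => i; rewrite (ord1 i).
  rewrite E2 in E1; apply: etrans E1 _; apply: eq_bigr => j _.
  have E3 := diff_coord (w ord0) j (smooth_differentiable sX Uphi).
  exact: (congr1 (fun t => beta phi ord0 j * t) (esym E3)).
exists v; rewrite gt_eqF //.
exact: (@wedge_contact_gt0 R F (frame_form ('d X phi) ('d beta phi))
  (extd (pullback iota a) p) extdE n (pullback iota a p)
  (fun v => dot (beta phi) ('d X phi v)) v pE v0 vt vs).
Qed.

End at_point.
End contact.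

(** * The sphere bundle as a submanifold *)

Section model_coordinates.
Context {R : realType} (n : nat).
Local Notation E := 'rV[R]_n.+1.
Local Notation Y := 'rV[R]_n.
Local Notation F := 'rV[R]_(2 * n).+1.

(** On row vectors the expansion along the standard basis replaces the continuity hypothesis of
    [smooth_linear]. *)
Lemma smooth_linear_rV m (V : normedModType R) (U : set 'rV[R]_m) (f : 'rV[R]_m -> V) :
  open U -> linear f -> smooth_on U f.
Proof.
move=> oU lf; pose fM := GRing.isLinear.Build _ _ _ _ _ lf.
pose fL : {linear 'rV[R]_m -> V} := HB.pack f fM.
apply: (@smooth_eq _ _ _ _ (fun x : 'rV[R]_m =>
    \sum_j ((x : 'rV[R]_m) ord0 j : R^o) *: f (delta_mx 0 j))) => //.
  move=> x _; rewrite {2}[x]row_sum_delta -[f _]/(fL _) linear_sum.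
  by apply: eq_bigr => j _; rewrite linearZ.
apply: smooth_sum => // j; apply: smooth_scale => //; last exact: smooth_cst.
by apply: smooth_linear; [exact: linear_coord|exact: continuous_coord].
Qed.

Lemma model_dim : (n.+1 + n = (2 * n).+1)%N. Proof. lia. Qed.

(** The dimensions [n.+1 + n] and [(2 * n).+1] are equal but not convertible, hence the cast. *)
Definition join_coord (x : E) (y : Y) : F := castmx (erefl, model_dim) (row_mx x y).
Definition base_coord (z : F) : E := lsubmx (castmx (esym (erefl 1%N), esym model_dim) z).
Definition fiber_coord (z : F) : Y := rsubmx (castmx (esym (erefl 1%N), esym model_dim) z).

Lemma base_join x y : base_coord (join_coord x y) = x.
Proof. by rewrite /base_coord /join_coord castmxK row_mxKl. Qed.

Lemma fiber_join x y : fiber_coord (join_coord x y) = y.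
Proof. by rewrite /fiber_coord /join_coord castmxK row_mxKr. Qed.

Lemma join_split z : join_coord (base_coord z) (fiber_coord z) = z.
Proof. by rewrite /base_coord /fiber_coord /join_coord hsubmxK castmxKV. Qed.

Lemma base_linear : linear base_coord.
Proof. by move=> a u v; apply/rowP => j; rewrite !(mxE, castmxE). Qed.

Lemma fiber_linear : linear fiber_coord.
Proof. by move=> a u v; apply/rowP => j; rewrite !(mxE, castmxE). Qed.

Lemma join_linear a x x' y y' :
  join_coord (a *: x + x') (a *: y + y') = a *: join_coord x y + join_coord x' y'.
Proof.
rewrite /join_coord -add_row_mx -scale_row_mx; apply/rowP => j.
by rewrite !(mxE, castmxE).
Qed.

Lemma base_smooth_on U : open U -> smooth_on U base_coord.
Proof. by move=> oU; apply: smooth_linear_rV => //; exact: base_linear. Qed.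

Lemma fiber_smooth_on U : open U -> smooth_on U fiber_coord.
Proof. by move=> oU; apply: smooth_linear_rV => //; exact: fiber_linear. Qed.

Lemma join_smooth (V : normedModType R) (U : set V) (x : V -> E) (y : V -> Y) :
  open U -> smooth_on U x -> smooth_on U y -> smooth_on U (fun v => join_coord (x v) (y v)).
Proof.
move=> oU sx sy.
apply: (@smooth_eq _ _ _ _ (fun v => join_coord (x v) 0 + join_coord 0 (y v))) => //.
  move=> v _; have := join_linear 1 (x v) 0 0 (y v).
  by rewrite !scale1r addr0 add0r => ->.
apply: smooth_add => //.
  apply: (smooth_comp (g := fun x => join_coord x 0) (fin_basis_rV _) oU openT _ sx) => //.
  apply: smooth_linear_rV; first exact: openT.
  by move=> a u v; rewrite -join_linear scaler0 addr0.
apply: (smooth_comp (g := fun y => join_coord 0 y) (fin_basis_rV _) oU openT _ sy) => //.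
apply: smooth_linear_rV; first exact: openT.
by move=> a u v; rewrite -join_linear scaler0 addr0.
Qed.

(* The affine chart of the projective space of [E] in which the coordinate [k]
   is normalized to 1. *)
Definition hat (k : 'I_n.+1) (y : Y) : E :=
  \row_j (if unlift k j is Some l then y ord0 l else 1).
Definition affine (k : 'I_n.+1) (w : E) : Y := \row_l (w ord0 (lift k l) / w ord0 k).

Lemma hat_k k y : hat k y ord0 k = 1. Proof. by rewrite mxE unlift_none. Qed.

Lemma affine_hat k y : affine k (hat k y) = y.
Proof. by apply/rowP => l; rewrite !mxE liftK unlift_none divr1. Qed.

Lemma affineZ k t (w : E) : t != 0 -> affine k (t *: w) = affine k w.
Proof.
move=> t0; apply/rowP => l; rewrite !mxE invfM mulrACA mulfV // mul1r //.
Qed.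

Lemma hat_affine k (w : E) : w ord0 k != 0 -> hat k (affine k w) = (w ord0 k)^-1 *: w.
Proof.
move=> wk; apply/rowP => j; rewrite !mxE; case: unliftP => [l ->|->]; rewrite ?mxE.
  by rewrite mulrC.
by rewrite mulVf.
Qed.

Lemma hat_smooth k (U : set Y) : open U -> smooth_on U (hat k).
Proof.
move=> oU; apply: smooth_rV => // j.
have [l ->|->] := unliftP k j.
  apply: (@smooth_eq _ _ _ _ (fun y : Y => y ord0 l : R^o)) => //.
    by move=> y _; rewrite mxE liftK.
  by apply: smooth_linear; [exact: linear_coord|exact: continuous_coord].
apply: (@smooth_eq _ _ _ _ (fun=> 1 : R^o)) => //; last exact: smooth_cst.
by move=> y _; rewrite hat_k.
Qed.

Lemma affine_smooth k (V : normedModType R) (U : set V) (w : V -> E) : open U ->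
  (forall v, U v -> w v ord0 k != 0) -> smooth_on U w ->
  smooth_on U (fun v => affine k (w v)).
Proof.
move=> oU w0 sw; apply: smooth_rV => // l.
apply: (@smooth_eq _ _ _ _ (fun v => w v ord0 (lift k l) * (w v ord0 k)^-1 : R^o)) => //.
  by move=> v _; rewrite mxE.
apply: smooth_mul => //; first exact: smooth_coord.
by apply: smooth_inv => //; exact: smooth_coord.
Qed.

(** The sign separates the two opposite rays of a line, which [affine] identifies. *)
Definition sgb (b : bool) : R := if b then 1 else -1.

Lemma sgb_sqr b : sgb b * sgb b = 1.
Proof. by case: b; rewrite /sgb ?mulr1 // mulrNN mulr1. Qed.

Lemma sgb_neq0 b : sgb b != 0.
Proof. by case: b; rewrite /sgb ?oppr_eq0 oner_eq0. Qed.

(** When [b] is the sign of [w_k], the ray of [w] is recovered, with factor 1/|w_k|. *)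
Lemma hat_affine_sgb k b (w : E) : 0 < sgb b * w ord0 k ->
  exists2 t, 0 < t & sgb b *: hat k (affine k w) = t *: w.
Proof.
move=> wk; exists (sgb b * w ord0 k)^-1; first by rewrite invr_gt0.
have wk0 : w ord0 k != 0.
  by apply: contraTneq wk => ->; rewrite mulr0 ltxx.
rewrite hat_affine // scalerA; congr (_ *: _); rewrite invfM; congr (_ * _).
by rewrite -[RHS]mulr1 -(sgb_sqr b) mulKf // sgb_neq0.
Qed.

Lemma hat_neq0 k b y : sgb b *: hat k y != 0.
Proof.
apply/eqP => /rowP /(_ k); rewrite !mxE unlift_none mulr1 => /eqP.
by rewrite (negbTE (sgb_neq0 b)).
Qed.

End model_coordinates.

(** * Normalization of vectors and the atlas of the sphere bundle *)

Section sphere.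
Context {R : realType} {n : nat}.
Local Notation E := 'rV[R]_n.+1.
Local Notation F := 'rV[R]_(2 * n).+1.
Variables (M : atlas E) (g : M -> E -> E -> R) (hg : riemannian_metric g).
Variables (r : M -> R) (hr0 : forall p, 0 < r p).
Local Notation TM := (tangent_bundle M).

(** An arbitrary nonzero default at 0 makes [to_sphere], and with it the inverse charts, total. *)
Definition nonzero (v : E) : E := if v == 0 then const_mx 1 else v.

Lemma nonzero_neq0 v : nonzero v != 0.
Proof.
rewrite /nonzero; case: (eqVneq v 0) => // _.
by apply/eqP => /rowP /(_ ord0); rewrite !mxE => /eqP; rewrite oner_eq0.
Qed.

Lemma nonzero_id v : v != 0 -> nonzero v = v.
Proof. by rewrite /nonzero => /negbTE ->. Qed.

Definition scale_to_sphere (p : M) (v : E) : E := (r p / Num.sqrt (g p v v)) *: v.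

Lemma metric_gt0 p v : v != 0 -> 0 < g p v v.
Proof. by case: hg => _ _ H _; exact: H. Qed.

Lemma scale_to_sphereP p v : v != 0 ->
  sphere_bundle g r ((p, scale_to_sphere p v) : TM).
Proof.
move=> v0; rewrite /sphere_bundle /= /scale_to_sphere /tproj /= (metricZZ hg).
have s0 : 0 < Num.sqrt (g p v v) by rewrite sqrtr_gt0 metric_gt0.
rewrite -{2}[g p v v]sqr_sqrtr; last exact: metric_ge0 hg _ _.
by rewrite -exprMn divfK ?gt_eqF // sqrtr_sqr gtr0_norm.
Qed.

Lemma scale_to_sphereZ p t v : 0 < t -> scale_to_sphere p (t *: v) = scale_to_sphere p v.
Proof.
move=> t0; rewrite /scale_to_sphere (metricZZ hg) sqrtrM ?sqr_ge0 // sqrtr_sqr gtr0_norm //.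
by rewrite scalerA invfM mulrA mulrAC divfK ?gt_eqF.
Qed.

Lemma scale_to_sphere_id (u : TM) : sphere_bundle g r u ->
  u.2 != 0 /\ scale_to_sphere u.1 u.2 = u.2.
Proof.
rewrite /sphere_bundle /tproj /= => H; split.
  by apply/eqP => u0; have := hr0 u.1; rewrite -H u0 (metric0l hg) sqrtr0 ltxx.
by rewrite /scale_to_sphere H mulfV ?scale1r // gt_eqF.
Qed.

Definition sphere_pt := {u : TM | sphere_bundle g r u}.

Lemma sphere_pt_inj (u v : sphere_pt) : sval u = sval v -> u = v.
Proof.
case: u v => [u pu] [v pv] /= uv; case: _ / uv in pv *.
by rewrite (Prop_irrelevance pu pv).
Qed.

Definition to_sphere (p : M) (v : E) : sphere_pt :=
  exist _ (p, scale_to_sphere p (nonzero v)) (scale_to_sphereP p (nonzero_neq0 v)).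

(** A point of the sphere bundle is determined by its ray, which is why the charts may forget the
    length of vectors. *)
Lemma to_sphereZ p t v : 0 < t -> to_sphere p (t *: v) = to_sphere p v.
Proof.
move=> t0; apply: sphere_pt_inj => /=; congr (_, _).
rewrite /nonzero scaler_eq0 gt_eqF //=; case: eqP => // _.
exact: scale_to_sphereZ.
Qed.

Lemma to_sphere_id (u : sphere_pt) : to_sphere (sval u).1 (sval u).2 = u.
Proof.
apply: sphere_pt_inj; case: u => -[p v] /= /scale_to_sphere_id [/= v0 vE].
by rewrite nonzero_id ?vE.
Qed.

Definition nonzero_coord (w : E) : 'I_n.+1 :=
  if [pick k | w ord0 k != 0] is Some k then k else ord0.

Lemma nonzero_coordP (w : E) : w != 0 ->
  0 < sgb (0 < w ord0 (nonzero_coord w)) * w ord0 (nonzero_coord w).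
Proof.
move=> w0; rewrite /nonzero_coord; case: pickP => [k wk|H].
  by rewrite /sgb; case: (ltrgt0P (w ord0 k)) wk => // wk _; rewrite ?mul1r // mulN1r oppr_gt0.
by case/eqP: w0; apply/rowP => k; rewrite mxE; apply/eqP/negPn; rewrite H.
Qed.

(* A chart of [M] and the sign of one of the induced fibre coordinates give a
   chart of the sphere bundle, by projection along rays to an affine hyperplane. *)
Definition sphere_atlas : atlas F := {|
  mpoint := sphere_pt;
  chart_index := (chart_index M * ('I_n.+1 * bool))%type;
  cdom := fun c => [set u : sphere_pt | cdom c.1 (sval u).1 /\
    0 < sgb c.2.2 * tcoord c.1 (sval u).1 (sval u).2 ord0 c.2.1];
  chart := fun c u => join_coord (chart c.1 (sval u).1)
    (affine c.2.1 (tcoord c.1 (sval u).1 (sval u).2));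
  chart_inv := fun c z => let p := chart_inv c.1 (base_coord z) in
    to_sphere p (tvect c.1 p (sgb c.2.2 *: hat c.2.1 (fiber_coord z)));
  chart_at := fun u => let w := (sval u).2 in
    (chart_at (sval u).1, (nonzero_coord w, 0 < w ord0 (nonzero_coord w))) |}.

End sphere.

(** * The sphere bundle is an embedded submanifold *)

Section sphere_manifold.
Context {R : realType} {n : nat}.
Local Notation E := 'rV[R]_n.+1.
Local Notation F := 'rV[R]_(2 * n).+1.
Variables (M : atlas E) (hM : smooth_atlas M).
Variables (g : M -> E -> E -> R) (hg : riemannian_metric g).
Variables (r : M -> R) (hr : smooth_fun setT r) (hr0 : forall p, 0 < r p).
Local Notation TM := (tangent_bundle M).
Local Notation tchart i := (@chart R (E * E)%type TM i).
Local Notation tcdom i := (@cdom R (E * E)%type TM i).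
Local Notation S := (sphere_atlas hg hr0).
Implicit Types (i j : chart_index M) (k l : 'I_n.+1) (b : bool) (z : F).

Definition sphere_incl (u : S) : TM := sval (u : sphere_pt g r).

Local Notation iota := sphere_incl.
Local Notation schart i k b := (@chart R F S (i, (k, b))).
Local Notation schart_inv i k b := (@chart_inv R F S (i, (k, b))).
Local Notation scdom i k b := (@cdom R F S (i, (k, b))).

(** Only the base coordinates are constrained: a chart of the sphere bundle maps onto an open set of
    the base times all of R^n. *)
Definition base_dom i j : set F := [set z | overlap i j (base_coord z)].

Lemma base_dom_open i j : open (base_dom i j).
Proof.
apply: (@open_comp _ _ (@base_coord R n)); last exact: overlap_open.
by move=> z _; exact: smooth_continuous (base_smooth_on openT) _.
Qed.

Lemma base_domW i j z : base_dom i j z -> base_dom i i z.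
Proof. by move=> [p [ip jp] E1]; exists p. Qed.

Definition ray k b z : E := sgb b *: hat k (fiber_coord z).

(** The fibre part of the inverse chart in the components of chart [i], with the norm expressed by
    the Gram matrix so that smoothness can be read off; [schart_invE] identifies the two. *)
Definition sphere_fiber i k b z : E := let p := chart_inv i (base_coord z) in
  (r p / Num.sqrt (dot (ray k b z *m gram g i p) (ray k b z))) *: ray k b z.

Lemma ray_quad_gt0 i k b z : base_dom i i z ->
  0 < dot (ray k b z *m gram g i (chart_inv i (base_coord z))) (ray k b z).
Proof.
move=> /(overlapP hM) [ip _ _]; rewrite /dot -(metric_gram hg).
apply: (metric_gt0 hg); apply/eqP => H; have := hat_neq0 k b (fiber_coord z).
by rewrite -(tvectK hM (sgb b *: _) ip) -/(ray k b z) H /tcoord linear0 eqxx.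
Qed.

Lemma sphere_fiber_pos i k b z : base_dom i i z ->
  exists2 t, 0 < t & sphere_fiber i k b z = t *: ray k b z.
Proof.
move=> dz; eexists; last by [].
by rewrite divr_gt0 // sqrtr_gt0 ray_quad_gt0.
Qed.

Lemma schart_invE i k b z : base_dom i i z -> let p := chart_inv i (base_coord z) in
  (iota (schart_inv i k b z)).1 = p /\
  tcoord i p (iota (schart_inv i k b z)).2 = sphere_fiber i k b z.
Proof.
move=> dz p; split => //; have /(overlapP hM) [ip _ _] := dz.
rewrite /= -/p -/(ray k b z).
have t0 : tvect i p (ray k b z) != 0.
  apply/eqP => H; have := hat_neq0 k b (fiber_coord z).
  by rewrite -(tvectK hM (sgb b *: _) ip) -/(ray k b z) H /tcoord linear0 eqxx.
rewrite nonzero_id // /scale_to_sphere (metric_gram hg) -/(dot _ _).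
have -> (t : R) v : tcoord i p (t *: v) = t *: tcoord i p v by rewrite /tcoord linearZ.
by rewrite tvectK.
Qed.

Lemma ray_smooth k b (U : set F) : open U -> smooth_on U (ray k b).
Proof.
move=> oU; apply: (@smooth_scale _ _ _ _ (fun=> sgb b : R^o)) => //; first exact: smooth_cst.
exact: (smooth_comp (fin_basis_rV _) oU openT _ (fiber_smooth_on oU) (hat_smooth k openT)).
Qed.

Lemma sphere_fiber_smooth i k b : smooth_on (base_dom i i) (sphere_fiber i k b).
Proof.
have oD := @base_dom_open i i; have oO := overlap_open hM i i.
have sb := @base_smooth_on R n _ oD; have sw := ray_smooth k b oD.
have sG (m l : 'I_n.+1) : smooth_on (base_dom i i)
    (fun z => gram g i (chart_inv i (base_coord z)) m l : R^o).
  have sg := gram_smooth hM hg i m l; rewrite overlap_id in sg.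
  exact: (smooth_comp (fin_basis_rV _) oD oO _ sb sg).
have sr : smooth_on (base_dom i i) (fun z => r (chart_inv i (base_coord z)) : R^o).
  have sr' : smooth_on (overlap i i) (r \o chart_inv i : E -> R^o).
    by have := hr i; rewrite setTI overlap_id.
  exact: (smooth_comp (fin_basis_rV _) oD oO _ sb sr').
apply: smooth_scale => //; apply: smooth_mul => //; apply: smooth_inv => //.
  by move=> z dz; rewrite gt_eqF // sqrtr_gt0 ray_quad_gt0.
apply: smooth_sqrt => //; first by move=> z dz; exact: ray_quad_gt0.
apply: smooth_sum => // l; apply: smooth_mul => //; last exact: smooth_coord.
apply: (@smooth_eq _ _ _ _ (fun z => \sum_m ray k b z ord0 m *
    gram g i (chart_inv i (base_coord z)) m l : R^o)) => //.
  by move=> z _; rewrite [RHS]mxE.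
by apply: smooth_sum => // m; apply: smooth_mul => //; exact: smooth_coord.
Qed.

(** The inclusion read from a sphere chart to the chart [j] of TM. The smoothness of the inclusion
    and of the transition maps both reduce to it. *)
Definition sphere_rep i k b j z : E * E :=
  (chart j (chart_inv i (base_coord z)),
   'd (chart j \o chart_inv i) (base_coord z) (sphere_fiber i k b z)).

Lemma sphere_rep_smooth i k b j : smooth_on (base_dom i j) (sphere_rep i k b j).
Proof.
have oD := @base_dom_open i j; have oO := overlap_open hM i j.
have sb := @base_smooth_on R n _ oD; have sO := overlap_smooth hM i j.
apply: smooth_pair => //; first exact: (smooth_comp (fin_basis_rV _) oD oO _ sb sO).
apply: (smooth_diff_app (fin_basis_rV _) oD oO _ sO sb) => //.
apply: smooth_sub (sphere_fiber_smooth i k b) => z; exact: base_domW.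
Qed.

Lemma sphere_repE i k b j z : base_dom i j z ->
  tchart j (iota (schart_inv i k b z)) = sphere_rep i k b j z.
Proof.
move=> dz; have [E1 E2] := schart_invE k b (base_domW dz).
have /(overlapP hM) [ip jp xE] := dz.
move: (iota (schart_inv i k b z)) E1 E2 => -[q v] /= -> E2.
have := tcoord_trans hM v ip jp; rewrite xE E2 => <-.
by [].
Qed.

Lemma sphere_rep_id i k b z : base_dom i i z ->
  sphere_rep i k b i z = (base_coord z, sphere_fiber i k b z).
Proof.
move=> dz; have /(overlapP hM) [ip _ xE] := dz.
have := trans_id hM (sphere_fiber i k b z) ip; rewrite xE => E1.
by rewrite /sphere_rep xE E1.
Qed.

Lemma schart_rep i k b (u : S) :
  schart i k b u = join_coord (tchart i (iota u)).1 (affine k (tchart i (iota u)).2).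
Proof. by []. Qed.

Lemma scdomP i k b (u : S) : scdom i k b u <->
  cdom i (iota u).1 /\ 0 < sgb b * (tchart i (iota u)).2 ord0 k.
Proof. by []. Qed.

Lemma schart_invK i k b z : base_dom i i z ->
  scdom i k b (schart_inv i k b z) /\ schart i k b (schart_inv i k b z) = z.
Proof.
move=> dz; have [t t0 tE] := sphere_fiber_pos k b dz.
have /(overlapP hM) [ip _ xE] := dz.
rewrite scdomP schart_rep sphere_repE // sphere_rep_id //= tE; split.
  split=> //; rewrite /ray !mxE unlift_none mulr1 mulrCA sgb_sqr mulr1 //.
rewrite /ray scalerA affineZ ?affine_hat ?join_split //.
by rewrite mulf_neq0 ?sgb_neq0 // gt_eqF.
Qed.

Lemma tvectZ i p t v : tvect i p (t *: v) = t *: tvect i p v.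
Proof. by rewrite /tvect linearZ. Qed.

Lemma schartK i k b (u : S) : scdom i k b u -> schart_inv i k b (schart i k b u) = u.
Proof.
move=> [/= ip bp]; have [t t0 tE] := hat_affine_sgb bp.
rewrite /= base_join fiber_join (chartK hM) // tE tvectZ (tcoordK hM) //.
by rewrite to_sphereZ // to_sphere_id.
Qed.

Lemma schart_dom i k b (u : S) : scdom i k b u -> base_dom i i (schart i k b u).
Proof. by move=> [/= ip _]; rewrite /base_dom /= base_join; exact: overlap_chart. Qed.

Lemma schart_image i k b (A : set S) : A `<=` scdom i k b ->
  schart i k b @` A = [set z | base_dom i i z /\ A (schart_inv i k b z)].
Proof.
move=> Ai; apply/seteqP; split=> [_ [u Au <-]|z [dz Az]].
  by split; [exact/schart_dom/Ai|rewrite schartK //; exact: Ai].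
by exists (schart_inv i k b z) => //; have [] := schart_invK k b dz.
Qed.

Lemma open_pos (V : normedModType R) (U : set V) (h : V -> R^o) : open U ->
  smooth_on U h -> open (U `&` [set x | 0 < h x]).
Proof.
move=> oU sh; rewrite openE => x [Ux hx]; rewrite /interior; near=> y; split.
  by near: y; exact: open_near.
by near: y; exact: (cvgr_gt _ (smooth_continuous sh Ux) _ hx).
Unshelve. all: by end_near. Qed.

Lemma sphere_image_tcdom i k b j :
  schart i k b @` (scdom i k b `&` iota @^-1` tcdom j) = base_dom i j.
Proof.
rewrite schart_image; last by move=> u [].
apply/seteqP; split=> z.
  move=> [dz [_ /= jz]]; have /(overlapP hM) [ip _ xE] := dz.
  by rewrite /base_dom /= -xE; exact: overlap_chart.
move=> dz; have dz' := base_domW dz; split=> //.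
by have [? _] := schart_invK k b dz'; split=> //; have /(overlapP hM) [] := dz.
Qed.

Lemma sphere_image_scdom i k b j l b' :
  schart i k b @` (scdom i k b `&` scdom j l b')
  = base_dom i j `&` [set z | 0 < sgb b' * (sphere_rep i k b j z).2 ord0 l].
Proof.
rewrite schart_image; last by move=> u [].
apply/seteqP; split=> z.
  move=> [dz [_ [/= jz bz]]]; have /(overlapP hM) [ip _ xE] := dz.
  have dz' : base_dom i j z by rewrite /base_dom /= -xE; exact: overlap_chart.
  have H : 0 < sgb b' * (sphere_rep i k b j z).2 ord0 l by rewrite -sphere_repE.
  by split.
move=> [dz bz]; have dz' := base_domW dz; split=> //.
have [? _] := schart_invK k b dz'; split=> //; apply/scdomP.
by rewrite sphere_repE //; split=> //; have /(overlapP hM) [] := dz.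
Qed.

(** A transition map is [sphere_rep] followed by projection along rays, and its domain is cut out of
    [base_dom] by a strict inequality on a smooth function, hence open. *)
Lemma sphere_smooth_atlas : smooth_atlas S.
Proof.
have oI i k b j l b' : open (base_dom i j `&`
    [set z | 0 < sgb b' * (sphere_rep i k b j z).2 ord0 l]).
  apply: (@open_pos _ _ (fun z => sgb b' * (sphere_rep i k b j z).2 ord0 l : R^o)).
    exact: base_dom_open.
  apply: smooth_mul; [exact: base_dom_open|exact: smooth_cst|].
  apply: smooth_coord; first exact: base_dom_open.
  apply: (smooth_linear_comp (@linear_snd R E E) (@continuous_snd R E E)).
    exact: base_dom_open.
  exact: sphere_rep_smooth.
split.
- move=> u; have [u0 _] := scale_to_sphere_id hg hr0 (svalP u).
  split=> /=; first exact: cdom_at.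
  by rewrite (tcoord_at hM); exact: nonzero_coordP.
- by move=> [i [k b]] u; exact: schartK.
- by move=> [i [k b]] [j [l b']]; rewrite sphere_image_scdom.
- move=> [i [k b]] [j [l b']]; rewrite sphere_image_scdom.
  have sT : smooth_on (base_dom i j `&`
    [set z | 0 < sgb b' * (sphere_rep i k b j z).2 ord0 l]) (sphere_rep i k b j).
    by apply: smooth_sub (sphere_rep_smooth i k b j) => z [].
  apply: (@smooth_eq _ _ _ _ (fun z =>
      join_coord (sphere_rep i k b j z).1 (affine l (sphere_rep i k b j z).2))) => //.
    by move=> z [dz _]; rewrite -sphere_repE.
  apply: join_smooth => //.
    by apply: (smooth_linear_comp (@linear_fst R E E) (@continuous_fst R E E)).
  apply: affine_smooth => //.
    by move=> z [_ /=]; apply: contraTneq => ->; rewrite mulr0 ltxx.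
  by apply: (smooth_linear_comp (@linear_snd R E E) (@continuous_snd R E E)).
Qed.

Lemma sphere_incl_smooth : smooth_map iota.
Proof.
move=> [i [k b]] j; rewrite sphere_image_tcdom; split; first exact: base_dom_open.
apply: smooth_eq (sphere_rep_smooth i k b j); first exact: base_dom_open.
by move=> z dz; rewrite -sphere_repE.
Qed.

(** Extends the sphere charts to an open set of TM. As a smooth left inverse of the inclusion in
    charts it serves for the immersion property and for the induced topology. *)
Definition ray_proj k (x : E * E) : F := join_coord x.1 (affine k x.2).

Lemma ray_proj_smooth k :
  open [set x : E * E | x.2 ord0 k != 0] /\
  smooth_on [set x : E * E | x.2 ord0 k != 0] (ray_proj k).
Proof.
have oU : open [set x : E * E | x.2 ord0 k != 0].
  have -> : [set x : E * E | x.2 ord0 k != 0] =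
      (fun x : E * E => (x.2 : E) ord0 k : R^o) @^-1` (~` [set 0]).
    by apply/seteqP; split=> x /eqP.
  apply: open_comp; last by rewrite openC; exact: closed_eq.
  move=> x _; apply: (@continuous_comp _ _ _ snd (fun w : E => w ord0 k : R^o)).
    exact: continuous_snd.
  exact: continuous_coord.
split=> //; apply: join_smooth => //.
  by apply: smooth_linear; [exact: linear_fst|exact: continuous_fst].
apply: affine_smooth => //.
by apply: smooth_linear; [exact: linear_snd|exact: continuous_snd].
Qed.

Lemma ray_proj_differentiable k (x : E * E) : x.2 ord0 k != 0 -> differentiable (ray_proj k) x.
Proof. by move=> x0; have [_ /smooth_differentiable] := ray_proj_smooth k; apply. Qed.

Lemma scdom_coord_neq0 i k b (u : S) : scdom i k b u -> (tchart i (iota u)).2 ord0 k != 0.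
Proof. by move=> /scdomP [_]; apply: contraTneq => ->; rewrite mulr0 ltxx. Qed.

(** By the chain rule, the differential of [ray_proj k] is a left inverse of that of the
    inclusion. *)
Lemma sphere_immersion (u : S) : injective (differential iota u).
Proof.
set i := @chart_at R E M (iota u).1.
set k := nonzero_coord (iota u).2; set b := 0 < (iota u).2 ord0 k.
have cu : scdom i k b u by exact: (cdom_at sphere_smooth_atlas).
have iu : tcdom i (iota u) by have [] := cu.
have dF := smooth_map_differentiable sphere_incl_smooth cu iu.
set z := schart i k b u in dF.
pose rep := tchart i \o iota \o schart_inv i k b.
have repz : rep z = tchart i (iota u) := congr1 (fun q => tchart i (iota q)) (schartK cu).
have dP : differentiable (ray_proj k) (rep z).
  by apply: ray_proj_differentiable; rewrite repz; exact: scdom_coord_neq0 cu.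
have H v : 'd (ray_proj k) (rep z) ('d rep z v) = v.
  have Hn : \forall y \near z, id y = (ray_proj k \o rep) y.
    have dn : \forall y \near z, base_dom i i y.
      exact: (open_near (@base_dom_open i i) (schart_dom cu)).
    near=> y; have dy : base_dom i i y by near: y.
    by have [_ E1] := schart_invK k b dy; symmetry; exact: E1.
  rewrite -diff_compE // (near_diff v Hn) //.
  by rewrite (is_diff_val _ (is_diff_id _)).
move=> v v' vv'; exact: etrans (esym (H v)) (etrans (congr1 _ vv') (H v')).
Unshelve. all: by end_near. Qed.

Lemma tchartK i (u : TM) : cdom i u.1 -> @chart_inv R (E * E)%type TM i (tchart i u) = u.
Proof. by case: u => p v /= ip; rewrite (chartK hM ip) (tcoordK hM). Qed.

(** An open set of the sphere bundle is the trace of the cone of rays through it, and this cone is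
    open since projection along rays is continuous in charts. The converse is the continuity of the
    inclusion. *)
Lemma sphere_topology (O : set S) : open O <-> exists2 Q, open Q & O = iota @^-1` Q.
Proof.
split=> [oO|[Q oQ ->]].
  pose Q : set TM := [set u | u.2 != 0 /\ O (to_sphere hg hr0 u.1 u.2)].
  exists Q; last first.
    apply/seteqP; split=> u.
      move=> Ou; have [u0 _] := scale_to_sphere_id hg hr0 (svalP u).
      by split=> //=; rewrite to_sphere_id.
    by move=> [_ /=]; rewrite to_sphere_id.
  suff H (u : TM) i : Q u -> cdom i u.1 ->
      \forall y \near tchart i u, Q (@chart_inv R (E * E)%type TM i y).
    by move=> u i; exact: H.
  move=> [u0 Ou] iu; pose w := tcoord i u.1 u.2.
  have w0 : w != 0.
    by apply: contra_neq u0 => H; rewrite -(tcoordK hM u.2 iu) -/w H /tvect linear0.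
  set k := nonzero_coord w; set b := 0 < w ord0 k.
  have bw : 0 < sgb b * w ord0 k by exact: nonzero_coordP.
  (* The normalization of [u] is a positive multiple of it, so it lies in the sphere chart of the
     same coordinate and sign, and has the same image under [ray_proj k]. *)
  pose s : S := to_sphere hg hr0 u.1 u.2.
  have [t t0 sE] : exists2 t, 0 < t & (iota s).2 = t *: u.2.
    rewrite /= nonzero_id //; eexists; last by [].
    by rewrite divr_gt0 // sqrtr_gt0 (metric_gt0 hg).
  have tE : (tchart i (iota s)).2 = t *: w.
    by rewrite /= [X in tcoord _ _ X]sE /tcoord linearZ.
  have cs : scdom i k b s.
    apply/scdomP; split=> //; rewrite tE mxE mulrCA; exact: mulr_gt0.
  have zE : schart i k b s = ray_proj k (tchart i u).
    by rewrite schart_rep tE affineZ // gt_eqF.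
  have wk : (tchart i u).2 ord0 k != 0.
    by apply: contraTneq bw => H; rewrite -[w]/((tchart i u).2) H mulr0 ltxx.
  have Hz : \forall z \near ray_proj k (tchart i u), O (schart_inv i k b z).
    by rewrite -zE; exact: (oO s (i, (k, b))).
  have Pc := differentiable_continuous (ray_proj_differentiable wk).
  have Hy : \forall y \near tchart i u, O (schart_inv i k b (ray_proj k y)) := Pc _ Hz.
  have Hd : \forall y \near tchart i u, overlap i i y.1.
    apply: (@continuous_fst _ _ _ (tchart i u)).
    exact: (overlap_near hM iu iu).
  have Hb : \forall y \near tchart i u, 0 < sgb b * (y.2 : E) ord0 k.
    have s2 : smooth_on setT (fun y : E * E => (y.2 : E) ord0 k : R^o).
      apply: smooth_coord; first exact: openT.
      by apply: smooth_linear; [exact: linear_snd|exact: continuous_snd].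
    have sk := smooth_mul openT (smooth_cst setT (sgb b : R^o)) s2.
    have oP := open_pos openT sk; rewrite setTI in oP.
    exact: (open_near oP).
  near=> y.
  have by0 : 0 < sgb b * (y.2 : E) ord0 k by near: y.
  have /(overlapP hM) [iy _ yE] : overlap i i y.1 by near: y.
  have Oy : O (schart_inv i k b (ray_proj k y)) by near: y.
  have y0 : y.2 != 0 by apply: contraTneq by0 => ->; rewrite mxE mulr0 ltxx.
  split=> /=.
    by apply: contra_neq y0 => H; rewrite -(tvectK hM y.2 iy) H /tcoord linear0.
  (* Projecting along the ray and applying the inverse sphere chart gives the same point as
     normalizing directly, the two vectors being positively proportional. *)
  have [t' t'0 t'E] := hat_affine_sgb by0.
  move: Oy; rewrite /ray_proj /= base_join fiber_join t'E tvectZ to_sphereZ //.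
suff H (u : S) i k b : Q (iota u) -> scdom i k b u ->
    \forall z \near schart i k b u, Q (iota (schart_inv i k b z)).
  by move=> u [i [k b]]; exact: H.
move=> Ou cu; have iu : tcdom i (iota u) by have [] := cu.
have Hy : \forall y \near tchart i (iota u), Q (@chart_inv R (E * E)%type TM i y).
  exact: (oQ (iota u) i).
have dF := smooth_map_differentiable sphere_incl_smooth cu iu.
have cF := differentiable_continuous dF.
have repz : (tchart i \o iota \o schart_inv i k b) (schart i k b u) = tchart i (iota u) :=
  congr1 (fun q => tchart i (iota q)) (schartK cu).
rewrite /prop_for /continuous_at repz in cF.
have Hz : \forall z \near schart i k b u,
   Q (@chart_inv R (E * E)%type TM i (tchart i (iota (schart_inv i k b z)))) := cF _ Hy.
have dn : \forall z \near schart i k b u, base_dom i i z.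
  exact: (open_near (@base_dom_open i i) (schart_dom cu)).
near=> z; have dz : base_dom i i z by near: z.
have Oz : Q (@chart_inv R (E * E)%type TM i (tchart i (iota (schart_inv i k b z)))) by near: z.
have [cz _] := schart_invK k b dz; have iz : cdom i (iota (schart_inv i k b z)).1 by case: cz.
exact: (eq_ind _ Q Oz _ (tchartK iz)).
Unshelve. all: by end_near. Qed.

Lemma sphere_embedding : submanifold_embedding iota (sphere_bundle g r).
Proof.
split.
- exact: sphere_smooth_atlas.
- exact: sphere_incl_smooth.
- exact: sphere_immersion.
- split; first by move=> u v; exact: sphere_pt_inj.
  apply/seteqP; split=> [_ [u _ <-]|u uS]; first exact: (svalP u).
  by exists (exist _ u uS).
- exact: sphere_topology.
Qed.

End sphere_manifold.

Theorem theorem0p3 (R : realType) (n : nat) (hn : (1 <= n)%N)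
  (M : atlas 'rV[R]_n.+1) (hM : smooth_manifold M)
  (g : M -> 'rV[R]_n.+1 -> 'rV[R]_n.+1 -> R) (hg : riemannian_metric g)
  (nabla : M -> 'rV[R]_n.+1 -> (M -> 'rV[R]_n.+1) -> 'rV[R]_n.+1)
  (hnabla : metric_connection g nabla)
  (nablas : tangent_bundle M -> 'rV[R]_n.+1 * 'rV[R]_n.+1 ->
              (tangent_bundle M -> 'rV[R]_n.+1) -> 'rV[R]_n.+1)
  (hnablas : pullback_connection (@tproj R 'rV[R]_n.+1 M) nabla nablas)
  (r : M -> R) (hr : smooth_fun setT r) (hr0 : forall p, 0 < r p) :
  (exists (S : atlas 'rV[R]_(2 * n).+1) (iota : S -> tangent_bundle M),
     submanifold_embedding iota (sphere_bundle g r)) /\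
  (forall (S : atlas 'rV[R]_(2 * n).+1) (iota : S -> tangent_bundle M),
     submanifold_embedding iota (sphere_bundle g r) ->
     contact_form n (pullback iota (mu g nablas))).
Proof.
have hMa : smooth_atlas M by case: hM.
have [hc _] := hnabla.
split.
  exists (sphere_atlas hg hr0), (@sphere_incl R n M g hg r hr0).
  exact: sphere_embedding.
move=> S iota emb p.
exact: (contact_at_point hMa hg hr hr0 emb p (muE hMa hc hnablas hg)).
Qed.
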